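(* Let $c_\beta,c_\eta,c_B>0$. There is a constant $C$ depending only on $L,\sigma,\Delta_f,c_\beta,c_\eta,c_B$ such that the following holds. Suppose Assumptions (A2), (A3), (A4) hold, $T\ge1$, and Lion-VR is run with $B_0=\max\{1,\lceil c_BT^{1/3}\rceil\}$, $\beta_2=c_\beta T^{-2/3}\le1$, $\beta_2\le\beta_1\le\sqrt{\beta_2}$, $\eta=c_\eta d^{-1/2}T^{-2/3}$, $0\le\lambda\le\frac1{2\eta T}$ and $\|\mathbf{x}_1\|_\infty\le\eta$. Then $$\frac1T\sum_{t=1}^T\mathbb{E}\left[\|\nabla f(\mathbf{x}_t)\|_1\right]\le C\,\frac{d^{1/2}}{T^{1/3}} .$$
   Context: Setting: $f:\mathbb{R}^d\to\mathbb{R}$ is accessed through a stochastic gradient oracle: at each query a sample $\xi$ is drawn from a fixed distribution, independently of everything before, and for this $\xi$ one may evaluate $\nabla f(\mathbf{x};\xi)$ at several points $\mathbf{x}$. $\|\cdot\|$ is the Euclidean norm, $\|\cdot\|_1,\|\cdot\|_\infty$ the $\ell_1$- and max-norms; $\operatorname{sign}$ acts coordinatewise with values in $\{-1,0,1\}$. (A2) $\mathbb{E}_\xi\|\nabla f(\mathbf{x};\xi)-\nabla f(\mathbf{y};\xi)\|^2\le L^2\|\mathbf{x}-\mathbf{y}\|^2$ for all $\mathbf{x},\mathbf{y}$. (A3) $\mathbb{E}_\xi[\nabla f(\mathbf{x};\xi)]=\nabla f(\mathbf{x})$ and $\mathbb{E}_\xi\|\nabla f(\mathbf{x};\xi)-\nabla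 f(\mathbf{x})\|^2\le\sigma^2$ for all $\mathbf{x}$. (A4) $f_*=\inf_{\mathbf{x}}f(\mathbf{x})>-\infty$ and $f(\mathbf{x}_1)-f_*\le\Delta_f$. Lion-VR: given $\mathbf{x}_1$, $\beta_1,\beta_2\in(0,1]$, $\eta>0$, $\lambda\ge0$, batch size $B_0$. At $t=1$ draw independent $\xi_1^1,\dots,\xi_1^{B_0}$ and set $\mathbf{v}_1=\mathbf{m}_1=\frac1{B_0}\sum_{i=1}^{B_0}\nabla f(\mathbf{x}_1;\xi_1^i)$. For $t\ge2$ draw a fresh $\xi_t$ and set $\mathbf{v}_t=(1-\beta_1)\mathbf{m}_{t-1}+\beta_1\nabla f(\mathbf{x}_t;\xi_t)$ and $\mathbf{m}_t=(1-\beta_2)\mathbf{m}_{t-1}+\beta_2\nabla f(\mathbf{x}_t;\xi_t)+(1-\beta_2)\big(\nabla f(\mathbf{x}_t;\xi_t)-\nabla f(\mathbf{x}_{t-1};\xi_t)\big)$. For all $t\ge1$: $\mathbf{x}_{t+1}=\mathbf{x}_t-\eta(\operatorname{sign}(\mathbf{v}_t)+\lambda\mathbf{x}_t)$. *)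

(* Defs.v *)
From HB Require Import structures.
From mathcomp Require Import all_boot all_order all_algebra.
From mathcomp Require Import all_classical all_reals all_analysis.
Set Implicit Arguments. Unset Strict Implicit. Unset Printing Implicit Defensive.
Import Order.TTheory GRing.Theory Num.Theory.
Import numFieldNormedType.Exports.
Local Open Scope classical_set_scope.
Local Open Scope ring_scope.

Section Defs.
Variable R : realType.

Definition dotv (d : nat) (u v : 'rV[R]_d) : R := \sum_(i < d) u 0 i * v 0 i.
Definition norm2 (d : nat) (v : 'rV[R]_d) : R := Num.sqrt (\sum_(i < d) v 0 i ^+ 2).
Definition norm1 (d : nat) (v : 'rV[R]_d) : R := \sum_(i < d) `|v 0 i|.
Definition normInf (d : nat) (v : 'rV[R]_d) : R := \big[Num.max/0]_(i < d) `|v 0 i|.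

Definition signv (d : nat) (v : 'rV[R]_d) : 'rV[R]_d := map_mx (fun a => Num.sg a) v.

(* Lion-VR, run on a realized sample sequence s : nat -> Xi.
   Samples s 0, ..., s (B0-1) form the initial batch xi_1^1..xi_1^{B0};
   sample s (B0 + t - 2) is the fresh sample xi_t used at step t >= 2.
   lion_state k = (x_{k+1}, x_{k+2}, m_{k+1}). *)
Fixpoint lion_state (d : nat) (Xi : Type) (G : 'rV[R]_d -> Xi -> 'rV[R]_d)
  (B0 : nat) (beta1 beta2 eta lambda : R) (x1 : 'rV[R]_d) (s : nat -> Xi)
  (k : nat) : 'rV[R]_d * 'rV[R]_d * 'rV[R]_d :=
  match k with
  | 0 =>
      let m1 := (B0%:R)^-1 *: \sum_(i < B0) G x1 (s i) in
      let v1 := m1 in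
      (x1, x1 - eta *: (signv v1 + lambda *: x1), m1)
  | k'.+1 =>
      let: (xp, x, m) := lion_state G B0 beta1 beta2 eta lambda x1 s k' in
      let xi := s (B0 + k')%N in
      let g := G x xi in
      let gp := G xp xi in
      let v := (1 - beta1) *: m + beta1 *: g in
      let m' := (1 - beta2) *: m + beta2 *: g + (1 - beta2) *: (g - gp) in
      (x, x - eta *: (signv v + lambda *: x), m')
  end.

Definition lion_x (d : nat) (Xi : Type) (G : 'rV[R]_d -> Xi -> 'rV[R]_d)
  (B0 : nat) (beta1 beta2 eta lambda : R) (x1 : 'rV[R]_d) (s : nat -> Xi)
  (t : nat) : 'rV[R]_d :=
  (lion_state G B0 beta1 beta2 eta lambda x1 s t.-1).1.1.

Definition iid_seq (dO dX : measure_display) (Omega : measurableType dO)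
  (Xi : measurableType dX) (P : probability Omega R) (mu : probability Xi R)
  (X : nat -> Omega -> Xi) : Prop :=
  (forall n, measurable_fun setT (X n)) /\
  (forall n (A : set Xi), measurable A -> P (X n @^-1` A) = mu A) /\
  (forall (J : seq nat) (A : nat -> set Xi), uniq J ->
     (forall n, measurable (A n)) ->
     P (\bigcap_(n in [set` J]) (X n @^-1` A n)) =
     (\prod_(n <- J) P (X n @^-1` A n))%E).

End Defs.

(* Main.v *)
(* The direction is a sign vector, so every iterate x_t takes finitely many
   values; conditioning a fresh gradient on the past is then a finite sum over
   those values. Writing e_t = E|m_t - grad f(x_t)|^2, the orthogonality of the
   martingale increments gives
     e_{t+1} <= (1 - beta2)^2 e_t + 2 beta2^2 sigma^2 + 8 L^2 D,
   where D = (9/4) eta^2 d bounds |x_{t+1} - x_t|^2 because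
   lambda |x_t|_oo <= 1/2; summing, the average of e_t is O(T^(-2/3)). On the
   other hand, f decreases at each step by at least (eta/2) |grad f(x_t)|_1, up
   to 2 eta |grad f(x_t) - v_t|_1 and O(eta^2 d), and the l1 error is absorbed
   through 2|u|_1 <= a|u|^2 + d/a with a = d^(1/2) T^(1/3). *)

Require Import Defs.
From HB Require Import structures.
From mathcomp Require Import all_boot all_order all_algebra.
From mathcomp Require Import all_classical all_reals all_analysis.
From mathcomp Require Import measurable_realfun ring lra.
Import Order.TTheory GRing.Theory Num.Theory.
Import numFieldNormedType.Exports.
Local Open Scope classical_set_scope.
Local Open Scope ring_scope.

(** Put tau = T^(1/3) and delta = d^(1/2). Then eta is of order 1 / (delta tau^2), eta^2 d of order
    tau^-4 and beta2 of order tau^-2. In the summed recursion, beta2 times the sum of the e_t is at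
    most e_1 + T O(beta2^2 + eta^2 d); the last term is of order 1 / tau, and a batch of size about
    tau brings e_1 <= sigma^2 / B0 down to the same order. With this choice of a, the three
    quantities (f(x_1) - inf f) / (eta T), a times the average of e_t, and d / a are all of order
    delta / tau. The obstacle is that the oracle is evaluated at random iterates. The momentum
    ranges over a continuum, but it enters its error recursion linearly, so only the pair of
    consecutive iterates has to be frozen; randomness reaches that pair through signs alone. *)

Section Vectors.
Context {R : realType} {d : nat}.
Implicit Types u v w : 'rV[R]_d.

Lemma sqr_norm2 v : norm2 v ^+ 2 = \sum_(i < d) v 0 i ^+ 2.
Proof. by rewrite sqr_sqrtr// sumr_ge0// => i _; exact: sqr_ge0. Qed.

Lemma sqr_norm2_ge0 v : 0 <= norm2 v ^+ 2.
Proof. exact: sqr_ge0. Qed.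

Lemma sqr_norm2N v : norm2 (- v) ^+ 2 = norm2 v ^+ 2.
Proof. by rewrite !sqr_norm2; apply: eq_bigr => i _; rewrite mxE sqrrN. Qed.

Lemma sqr_norm2Z a v : norm2 (a *: v) ^+ 2 = a ^+ 2 * norm2 v ^+ 2.
Proof.
by rewrite !sqr_norm2 mulr_sumr; apply: eq_bigr => i _; rewrite mxE exprMn.
Qed.

Lemma sqr_norm2D_le u v :
  norm2 (u + v) ^+ 2 <= 2 * norm2 u ^+ 2 + 2 * norm2 v ^+ 2.
Proof.
rewrite !sqr_norm2 !mulr_sumr -big_split/=; apply: ler_sum => i _.
rewrite mxE; have := sqr_ge0 (u 0 i - v 0 i); nra.
Qed.

Lemma sqr_norm2D3_le u v w :
  norm2 (u + v + w) ^+ 2 <=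
  3 * norm2 u ^+ 2 + 3 * norm2 v ^+ 2 + 3 * norm2 w ^+ 2.
Proof.
rewrite !sqr_norm2 !mulr_sumr -!big_split/=; apply: ler_sum => i _.
rewrite !mxE; have := sqr_ge0 (u 0 i - v 0 i); have := sqr_ge0 (u 0 i - w 0 i).
have := sqr_ge0 (v 0 i - w 0 i); nra.
Qed.

Lemma norm1_ge0 v : 0 <= norm1 v.
Proof. exact: sumr_ge0. Qed.

(** Coordinatewise this is a (|v_i| - 1/a)^2 >= 0. The weight [a] stays free so that it can balance
    the variance against the dimension. *)
Lemma norm1_young a v : 0 < a ->
  2 * norm1 v <= a * norm2 v ^+ 2 + d%:R / a.
Proof.
move=> a0; have -> : d%:R / a = \sum_(i < d) a^-1.
  by rewrite sumr_const card_ord mulr_natl.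
rewrite sqr_norm2 !mulr_sumr -big_split/=; apply: ler_sum => i _.
rewrite -(real_normK (num_real (v 0 i))).
have /(mulr_ge0 (ltW a0)) := sqr_ge0 (`|v 0 i| - a^-1).
suff -> : a * (`|v 0 i| - a^-1) ^+ 2 =
  a * `|v 0 i| ^+ 2 - 2 * `|v 0 i| + a^-1 by lra.
by field; rewrite gt_eqF.
Qed.

Lemma dotvDr u v w : dotv u (v + w) = dotv u v + dotv u w.
Proof.
by rewrite /dotv -big_split/=; apply: eq_bigr => i _; rewrite mxE mulrDr.
Qed.

Lemma dotvDl u v w : dotv (v + w) u = dotv v u + dotv w u.
Proof.
by rewrite /dotv -big_split/=; apply: eq_bigr => i _; rewrite mxE mulrDl.
Qed.

Lemma dotvZr a u v : dotv u (a *: v) = a * dotv u v.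
Proof.
by rewrite /dotv mulr_sumr; apply: eq_bigr => i _; rewrite mxE mulrCA.
Qed.

Lemma dotvNr u v : dotv u (- v) = - dotv u v.
Proof. by rewrite -scaleN1r dotvZr mulN1r. Qed.

Lemma dotv_young u v : 2 * dotv u v <= norm2 u ^+ 2 + norm2 v ^+ 2.
Proof.
rewrite !sqr_norm2 mulr_sumr -big_split/=; apply: ler_sum => i _.
have := sqr_ge0 (u 0 i - v 0 i); nra.
Qed.

(** Where the signs of u_i and v_i agree nothing is lost. Elsewhere |u_i| <= |u_i - v_i|, and the
    loss is at most 2 |u_i|. *)
Lemma dotv_sign_ge u v : norm1 u - 2 * norm1 (u - v) <= dotv u (signv v).
Proof.
rewrite /norm1 /dotv mulr_sumr -sumrB; apply: ler_sum => i _.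
rewrite !mxE; move: (u 0 i) (v 0 i) => a b.
by case: (sgrP b) => b0; case: (ger0P a) => a0; case: (ger0P (a - b)) => ab; lra.
Qed.

Lemma ler_dotv_norm1 u v c : (forall i, `|v 0 i| <= c) ->
  dotv u v <= c * norm1 u.
Proof.
move=> vc; rewrite /dotv /norm1 mulr_sumr; apply: ler_sum => i _.
apply: le_trans (ler_norm _) _; rewrite normrM mulrC.
by rewrite ler_wpM2r.
Qed.

Lemma normInf_ge v i : `|v 0 i| <= normInf v.
Proof. exact: (le_bigmax 0 (fun i => `|v 0 i|) i). Qed.

End Vectors.

(** * Descent inequality for a function with Lipschitz gradient *)

Section Descent.
Context {R : realType} {d : nat}.
Variables (f : 'rV[R]_d -> R) (gradf : 'rV[R]_d -> 'rV[R]_d) (L : R).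
Hypothesis gradP : forall x v : 'rV[R]_d, is_derive x v f (dotv (gradf x) v).
Hypothesis grad_lip : forall x y,
  norm2 (gradf x - gradf y) ^+ 2 <= L ^+ 2 * norm2 (x - y) ^+ 2.

(** [gradP] speaks of directional derivatives, so the chain rule is replaced by the remark that the
    two difference quotients are the same function of [h]. *)
Lemma is_derive_line (x v : 'rV[R]_d) (t : R) :
  is_derive t 1 (fun s => f (x + s *: v)) (dotv (gradf (x + t *: v)) v).
Proof.
have [dv vE] := gradP (x + t *: v) v.
have lineE : (fun h : R => h^-1 *:
    (((fun s => f (x + s *: v)) \o shift t) (h *: (1 : R)) - f (x + t *: v))) =
  (fun h : R => h^-1 *:
    ((f \o shift (x + t *: v)) (h *: v) - f (x + t *: v))).
  apply/funext => h /=; congr (_ *: (f _ - _)).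
  by rewrite -[h *: 1]/(h * 1) mulr1 scalerDl addrCA.
split; first by rewrite /derivable lineE.
by rewrite -vE /derive lineE.
Qed.

(* The remainder is [<u, v>] with [|u| <= |L| |v|], bounded by
   [(|u|^2 + |v|^2) / 2]; this loses the sharp constant L / 2. *)
Lemma descent (x v : 'rV[R]_d) :
  f (x + v) <= f x + dotv (gradf x) v + (L ^+ 2 + 1) / 2 * norm2 v ^+ 2.
Proof.
have dl t := is_derive_line x v t.
have [|c c01] := @MVT_segment R _ _ 0 1 ler01 (fun t _ => dl t).
  by apply: derivable_within_continuous => t _; exact: (@ex_derive _ _ _ _ _ _ _ (dl t)).
rewrite scale1r scale0r addr0 subr0 mulr1 => fE.
have -> : f (x + v) = f x + dotv (gradf x) v +
    dotv (gradf (x + c *: v) - gradf x) v.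
  rewrite -[f (x + v)](subrK (f x)) fE [LHS]addrC -addrA; congr (_ + _).
  by rewrite -dotvDl addrCA subrr addr0.
rewrite lerD2l.
have := dotv_young (gradf (x + c *: v) - gradf x) v.
have := grad_lip (x + c *: v) x.
rewrite addrAC subrr add0r sqr_norm2Z.
have c2 : c ^+ 2 <= 1.
  by move: c01; rewrite in_itv/= => /andP[? ?]; rewrite expr_le1.
have cL : L ^+ 2 * (c ^+ 2 * norm2 v ^+ 2) <= L ^+ 2 * norm2 v ^+ 2.
  by rewrite ler_wpM2l ?sqr_ge0// ler_piMl// sqr_ge0.
lra.
Qed.

(** * Sign iterations with weight decay, along an arbitrary deterministic direction sequence *)

Variables (eta lambda : R) (x v : nat -> 'rV[R]_d).
Hypotheses (eta0 : 0 < eta) (lambda0 : 0 <= lambda).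
Hypothesis xS : forall k,
  x k.+1 = x k - eta *: (signv (v k) + lambda *: x k).
Hypothesis x0 : forall i, `|x 0%N 0 i| <= eta.

(** The decay multiplies a coordinate by a factor in [0, 1], and the sign moves it by at most eta;
    the start accounts for the first eta. *)
Lemma sign_iterate_coord k i : eta * lambda <= 1 ->
  `|x k 0 i| <= k.+1%:R * eta.
Proof.
move=> el1; elim: k => [|k IH]; first by rewrite mul1r.
rewrite xS !mxE.
have -> : x k 0 i - eta * (Num.sg (v k 0 i) + lambda * x k 0 i) =
  (1 - eta * lambda) * x k 0 i - eta * Num.sg (v k 0 i) by ring.
apply: le_trans (ler_normB _ _) _; rewrite !normrM (gtr0_norm eta0).
rewrite ger0_norm ?subr_ge0// normr_sg.
have s1 : eta * (v k 0 i != 0)%:R <= eta.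
  by case: (_ != _); rewrite ?mulr1 ?mulr0// ltW.
have s2 : (1 - eta * lambda) * `|x k 0 i| <= `|x k 0 i|.
  by rewrite ler_piMl// gerBl mulr_ge0// ltW.
by rewrite -[k.+2]addn1 natrD mulrDl mul1r; lra.
Qed.

Variable T : nat.
Hypothesis lambdaT : lambda <= (2 * eta * T%:R)^-1.

(** As k + 1 <= T, the linear growth stays below T eta, which the cap on lambda turns into 1/2. *)
Lemma sign_iterate_decay k i : (k < T)%N -> lambda * `|x k 0 i| <= 2^-1.
Proof.
move=> kT.
have T0 : 0 < T%:R :> R by rewrite ltr0n (leq_trans _ kT).
have lT : lambda * (2 * eta * T%:R) <= 1.
  by rewrite -ler_pdivlMr ?mul1r// !mulr_gt0.
have T1 : 1 <= T%:R :> R by rewrite ler1n (leq_trans _ kT).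
have el1 : eta * lambda <= 1.
  have : 0 <= lambda * eta by rewrite mulr_ge0// ltW.
  nra.
have := sign_iterate_coord k i el1.
have : k.+1%:R * eta <= T%:R * eta by rewrite ler_wpM2r ?(ltW eta0)// ler_nat.
move=> h1 h2; have := ler_wpM2l lambda0 (le_trans h2 h1); lra.
Qed.

Lemma sign_iterate_step k : (k < T)%N ->
  norm2 (x k.+1 - x k) ^+ 2 <= 9 / 4 * eta ^+ 2 * d%:R.
Proof.
move=> kT; rewrite xS addrAC subrr add0r sqr_norm2N sqr_norm2Z sqr_norm2.
rewrite -mulrA mulrCA ler_wpM2l ?sqr_ge0//.
(* 9/4 = (1 + 1/2)^2: a sign plus a decay term of size at most 1/2. *)
have -> : 9 / 4 * d%:R = \sum_(i < d) (9 / 4) :> R.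
  by rewrite sumr_const card_ord mulr_natr.
apply: ler_sum => i _; rewrite !mxE.
have /ler_normlP[] : `|lambda * x k 0 i| <= 2^-1.
  by rewrite normrM ger0_norm//; exact: sign_iterate_decay.
by case: sgrP; nra.
Qed.

(** The sign term gains eta times the l1 norm of the gradient, and the decay term can take back at
    most half of it. *)
Lemma sign_descent k : (k < T)%N ->
  f (x k.+1) <= f (x k) - eta / 2 * norm1 (gradf (x k)) +
    2 * eta * norm1 (gradf (x k) - v k) +
    (L ^+ 2 + 1) / 2 * (9 / 4 * eta ^+ 2 * d%:R).
Proof.
move=> kT; have := descent (x k) (x k.+1 - x k); rewrite addrC subrK => fS.
apply: le_trans fS _; apply: lerD; last first.
  rewrite ler_wpM2l// ?sign_iterate_step//.
  by have := sqr_ge0 L; lra.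
rewrite -addrA lerD2l xS addrAC subrr add0r -scaleNr dotvZr dotvDr.
have sgn := dotv_sign_ge (gradf (x k)) (v k).
have dec : dotv (gradf (x k)) (- (lambda *: x k)) <= 2^-1 * norm1 (gradf (x k)).
  apply: ler_dotv_norm1 => i; rewrite !mxE normrN normrM ger0_norm//.
  exact: sign_iterate_decay.
rewrite dotvNr in dec.
have : eta * (norm1 (gradf (x k)) - 2 * norm1 (gradf (x k) - v k) -
  2^-1 * norm1 (gradf (x k))) <=
  eta * (dotv (gradf (x k)) (signv (v k)) + dotv (gradf (x k)) (lambda *: x k)).
  by rewrite ler_wpM2l ?(ltW eta0)//; lra.
lra.
Qed.

Lemma sign_descent_sum (a Delta : R) : 0 < a -> has_lbound (range f) ->
  f (x 0%N) - inf (range f) <= Delta ->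
  \sum_(k < T) norm1 (gradf (x k)) <=
    2 * a * (\sum_(k < T) norm2 (gradf (x k) - v k) ^+ 2) +
    (2 * Delta / eta +
     T%:R * (2 * d%:R / a + 9 / 4 * (L ^+ 2 + 1) * (eta * d%:R))).
Proof.
move=> a0 fb fD.
set c := 2 * d%:R / a + 9 / 4 * (L ^+ 2 + 1) * (eta * d%:R).
have fk k : inf (range f) <= f (x k) by apply: ge_inf => //; exists (x k).
(* Keeping f (x n) in place of the infimum lets the function values telescope. Each step is
   multiplied by 2 / eta, so the l1 error appears with factor 4, twice what [norm1_young] bounds. *)
suff H n : (n <= T)%N ->
    \sum_(k < n) norm1 (gradf (x k)) <=
    2 * a * (\sum_(k < n) norm2 (gradf (x k) - v k) ^+ 2) +
    (2 * (f (x 0%N) - f (x n)) / eta + n%:R * c).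
  apply: le_trans (H T (leqnn T)) _; rewrite lerD2l lerD2r ler_wpM2r//.
    by rewrite invr_ge0 ltW.
  rewrite ler_pM2l//; have := fk T; lra.
elim: n => [|n IH] nT; first by rewrite !big_ord0 subrr !(mulr0, mul0r) !addr0.
rewrite !big_ord_recr/=.
have := IH (ltnW nT); have := sign_descent n nT.
have := norm1_young _ (gradf (x n) - v n) a0.
set Q := norm1 (_ - _); set N := norm1 (gradf _); set S := norm2 _ ^+ 2.
set A := \sum_(k < n) _; set B := \sum_(k < n) _ => yg ds ih.
have {}ds : N <= 2 * (f (x n) - f (x n.+1)) / eta + 4 * Q +
    9 / 4 * (L ^+ 2 + 1) * (eta * d%:R).
  rewrite -(ler_pM2l eta0).
  have -> : eta * (2 * (f (x n) - f (x n.+1)) / eta + 4 * Q +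
      9 / 4 * (L ^+ 2 + 1) * (eta * d%:R)) =
    2 * (f (x n) - f (x n.+1)) + 4 * eta * Q +
      9 / 4 * (L ^+ 2 + 1) * (eta ^+ 2 * d%:R) by field; rewrite gt_eqF.
  lra.
have -> : 2 * (f (x 0%N) - f (x n.+1)) / eta =
  2 * (f (x 0%N) - f (x n)) / eta + 2 * (f (x n) - f (x n.+1)) / eta by ring.
have -> : n.+1%:R * c = n%:R * c +
    (2 * (d%:R / a) + 9 / 4 * (L ^+ 2 + 1) * (eta * d%:R)).
  by rewrite -natr1 mulrDl mul1r [in RHS]mulrA.
lra.
Qed.

End Descent.

(** * Product formula for a real variable and an independent sample *)

Section Independence.
Context {R : realType} {dO dX : measure_display}.
Context {Omega : measurableType dO} {Xi : measurableType dX}.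
Variables (P : probability Omega R) (mu : probability Xi R).
Variables (Y : Omega -> R) (Z : Omega -> Xi).
Hypotheses (mY : measurable_fun setT Y) (mZ : measurable_fun setT Z).
Hypothesis indepYZ : forall A B, measurable A -> measurable B ->
  P (Y @^-1` A `&` Z @^-1` B) = (P (Y @^-1` A) * mu B)%E.
Variable phi : Xi -> R.
Hypotheses (iY : P.-integrable setT (EFin \o Y))
  (iphi : mu.-integrable setT (EFin \o phi)).

Let Ym : {RV P >-> R} := HB.pack Y (isMeasurableFun.Build _ _ _ _ _ mY).
Let mYZ : measurable_fun setT (fun w => (Y w, Z w)).
Proof. exact: measurable_fun_pair. Qed.
Let YZ : {RV P >-> (R * Xi)%type} :=
  HB.pack (fun w => (Y w, Z w)) (isMeasurableFun.Build _ _ _ _ _ mYZ).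

(** Independence gives agreement on rectangles, and a product measure is determined by its values
    there. *)
Let joint_law (g : R * Xi -> \bar R) :
  (\int[distribution P YZ]_p g p = \int[distribution P Ym \x mu]_p g p)%E.
Proof.
apply: eq_measure_integral => A mA _; apply/esym.
apply: product_measure_unique A mA => B C mB mC.
by rewrite /distribution /pushforward -indepYZ//; congr (P _).
Qed.

Let f (p : R * Xi) : \bar R := (p.1 * phi p.2)%:E.

Let mf : measurable_fun [set: R * Xi] f.
Proof.
apply/measurable_EFinP; apply: measurable_funM => //.
apply: measurableT_comp => //.
by apply/measurable_EFinP; exact: measurable_int iphi.
Qed.

Let if_ : (distribution P Ym \x mu)%E.-integrable [set: R * Xi] f.
Proof.
apply/integrable12ltyP => //.
pose K := (\int[mu]_z `|(phi z)%:E|)%E.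
have Klty : (K < +oo)%E by move/integrableP: iphi => [].
have K0 : (0 <= K)%E by exact: integral_ge0.
have Kfin : K \is a fin_num by rewrite ge0_fin_numE.
rewrite (_ : (fun x => _) = (fun y => K * `|y%:E|)%E); last first.
  apply/funext => y; rewrite muleC -ge0_integralZl//; last first.
  - by apply: measurableT_comp => //; exact: measurable_int iphi.
  - by apply: eq_integral => z _; rewrite /f/= normrM EFinM.
rewrite ge0_integralZl//; last by do 2! apply: measurableT_comp => //.
rewrite ge0_integral_distribution//; last by do 2! apply: measurableT_comp => //.
by rewrite lte_mul_pinfty//; move/integrableP: iY => [].
Qed.

Lemma integrable_indepM :
  P.-integrable setT (EFin \o (fun w => Y w * phi (Z w))).
Proof.
apply/integrableP; split.
  apply/measurable_EFinP; apply: measurable_funM => //.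
  apply: measurableT_comp => //.
  by apply/measurable_EFinP; exact: measurable_int iphi.
have /integrableP[_] := if_; rewrite -joint_law ge0_integral_distribution//.
exact: measurableT_comp.
Qed.

(** Fubini for the product law: integrating over the sample first replaces y phi(z) by c y. *)
Lemma integral_indepM (c : R) : (\int[mu]_z (phi z)%:E = c%:E)%E ->
  (\int[P]_w (Y w * phi (Z w))%:E = c%:E * \int[P]_w (Y w)%:E)%E.
Proof.
move=> phiE; have := integrable_indepM => iYZ.
rewrite -[LHS](@integral_distribution _ _ _ _ _ P YZ f mf iYZ) joint_law.
rewrite -(integral12_prod_meas1 if_)/= /fubini_F/f/=.
under eq_integral => y _.
  under eq_integral do rewrite EFinM.
  rewrite integralZl//= phiE muleC; over.
rewrite -[X in (_ * X)%E](@integral_distribution _ _ _ _ _ P Ym EFin)//.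
rewrite integralZl//.
exact: integrable_pushforward.
Qed.

End Independence.

(** * Expectations of nonnegative functions *)

Section ProbabilityIntegral.
Context {R : realType} {d : measure_display} {T : measurableType d}.
Variable P : probability T R.
Implicit Types f g h : T -> R.

Lemma ge0_integrable f r : measurable_fun setT f -> (forall w, 0 <= f w) ->
  (\int[P]_w (f w)%:E <= r%:E)%E -> P.-integrable setT (EFin \o f).
Proof.
move=> mf f0 fr; apply/integrableP; split; first exact/measurable_EFinP.
under eq_integral => w _ do rewrite /= ger0_norm//.
exact: le_lt_trans fr (ltry _).
Qed.

Lemma integral_prob_cst r : (\int[P]_w r%:E = r%:E)%E.
Proof. by rewrite integral_cst// [X in (_ * X)%E]probability_setT mule1. Qed.

(** Turns a pointwise estimate between squared norms into one between expectations. Nonnegativity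
    allows the integral to be split in the extended reals, so finiteness of the left side is a
    consequence. *)
Lemma ge0_integral_le_comb f g h a b c p q :
  measurable_fun setT f -> measurable_fun setT g -> measurable_fun setT h ->
  (forall w, 0 <= f w) -> (forall w, 0 <= g w) -> (forall w, 0 <= h w) ->
  0 <= a -> 0 <= b -> 0 <= c ->
  (forall w, f w <= a * g w + b * h w + c) ->
  (\int[P]_w (g w)%:E <= p%:E)%E -> (\int[P]_w (h w)%:E <= q%:E)%E ->
  (\int[P]_w (f w)%:E <= (a * p + b * q + c)%:E)%E.
Proof.
move=> mf mg mh f0 g0 h0 a0 b0 c0 fgh gp hq.
have ma : measurable_fun setT (fun w => a * g w) by exact: measurable_funM.
have mb : measurable_fun setT (fun w => b * h w) by exact: measurable_funM.
have ag0 w : 0 <= a * g w by rewrite mulr_ge0.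
have bh0 w : 0 <= b * h w by rewrite mulr_ge0.
apply: (@le_trans _ _ (\int[P]_w
    (((a * g w)%:E + (b * h w)%:E) + c%:E))%E).
  apply: ge0_le_integral => //=.
  - by move=> w _; rewrite lee_fin.
  - exact/measurable_EFinP.
  - by apply: emeasurable_funD => //; apply: emeasurable_funD;
      exact/measurable_EFinP.
  - by move=> w _; rewrite -!EFinD lee_fin.
rewrite ge0_integralD//=; last 2 first.
  - by move=> w _; rewrite -EFinD lee_fin addr_ge0.
  - by apply: emeasurable_funD; exact/measurable_EFinP.
rewrite ge0_integralD//=; last 4 first.
  - by move=> w _; rewrite lee_fin.
  - exact/measurable_EFinP.
  - by move=> w _; rewrite lee_fin.
  - exact/measurable_EFinP.
under eq_integral do rewrite EFinM.
rewrite [X in (_ + X + _ <= _)%E](_ : _ = \int[P]_w (b%:E * (h w)%:E))%E//.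
rewrite !ge0_integralZl_EFin//; last 4 first.
  - by move=> w _; rewrite lee_fin.
  - exact/measurable_EFinP.
  - by move=> w _; rewrite lee_fin.
  - exact/measurable_EFinP.
rewrite integral_prob_cst !EFinD !EFinM leeD// leeD// lee_wpmul2l//.
Qed.

End ProbabilityIntegral.

(** * Random variables with finitely many values *)

Section FinitelyValued.
Context {d : measure_display} {T : measurableType d}.

(** The list is exactly the range: every listed value is attained, so a property known at all [X w]
    passes to the members of the list. *)
Definition finitely_valued {S : eqType} (X : T -> S) :=
  (exists s : seq S, forall a, a \in s <-> exists w, X w = a) /\
  forall a, measurable (X @^-1` [set a]).

Lemma finitely_valued_finType {S : finType} (X : T -> S) :
  (forall a, measurable (X @^-1` [set a])) -> finitely_valued X.
Proof.
move=> mX; split=> //.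
exists [seq a <- enum S | `[< exists w, X w = a >]] => a.
rewrite mem_filter mem_enum andbT; split; first by move/asboolP.
by move=> ?; exact/asboolP.
Qed.

Lemma finitely_valued_comp {S S' : eqType} (X : T -> S) (g : S -> S') :
  finitely_valued X -> finitely_valued (g \o X).
Proof.
move=> [[s sP] mX]; split=> [|b].
  exists (map g s) => b; split.
    by move=> /mapP[a /sP[w <-] ->]; exists w.
  by move=> [w <-]; apply: map_f; apply/sP; exists w.
have -> : (g \o X) @^-1` [set b] =
    \bigcup_(a in [set a | a \in s /\ g a = b]) (X @^-1` [set a]).
  apply/seteqP; split=> [w /= gX|w [a [_ <-] /= <-]//].
  by exists (X w) => //; split=> //; apply/sP; exists w.
apply: fin_bigcup_measurable => //.
by apply: (sub_finite_set _ (finite_seq s)) => a [].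
Qed.

Lemma finitely_valued_pair {S S' : eqType} (X : T -> S) (X' : T -> S') :
  finitely_valued X -> finitely_valued X' ->
  finitely_valued (fun w => (X w, X' w)).
Proof.
move=> [[s sP] mX] [[s' sP'] mX']; split=> [|[a b]]; last first.
  rewrite (_ : _ @^-1` _ = X @^-1` [set a] `&` X' @^-1` [set b]).
    exact: measurableI.
  by apply/seteqP; split=> w /=; [case=> -> ->|case=> -> ->].
exists [seq p <- [seq (a, b) | a <- s, b <- s'] |
  `[< exists w, (X w, X' w) = p >]] => p.
rewrite mem_filter; split; first by move=> /andP[/asboolP].
move=> [w <-]; apply/andP; split; first by apply/asboolP; exists w.
by apply/allpairsP; exists (X w, X' w); split=> //;
  [apply/sP; exists w|apply/sP'; exists w].
Qed.

Context {R : realType}.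

(** Exactly one indicator is 1 at [w]; [undup] keeps it from being counted twice. *)
Lemma finitely_valued_sum {S : eqType} (X : T -> S) (s : seq S)
  (h : S -> T -> R) : (forall a, a \in s <-> exists w, X w = a) ->
  forall w, h (X w) w = \sum_(a <- undup s) \1_(X @^-1` [set a]) w * h a w.
Proof.
move=> sP w; have Xs : X w \in undup s by rewrite mem_undup; apply/sP; exists w.
rewrite (bigD1_seq (X w)) ?undup_uniq//= big1 ?addr0.
  by rewrite indicE mem_set//= mul1r.
move=> a aX; rewrite indicE memNset ?mul0r//= => Xa.
by rewrite Xa eqxx in aX.
Qed.

Lemma measurable_finitely_valued {S : eqType} (X : T -> S) (h : S -> T -> R) :
  finitely_valued X -> (forall a, measurable_fun setT (h a)) ->
  measurable_fun setT (fun w => h (X w) w).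
Proof.
move=> [[s sP] mX] mh; rewrite (funext (finitely_valued_sum X s h sP)).
by apply: measurable_sum => a; apply: measurable_funM.
Qed.

(** The sign vector factors through the pattern of comparisons with 0, an element of a finite type
    whose fibres are finite intersections of measurable sets. *)
Lemma finitely_valued_signv (n : nat) (Y : T -> 'rV[R]_n) :
  (forall i, measurable_fun setT (fun w => Y w 0 i)) ->
  finitely_valued (fun w => signv (Y w)).
Proof.
move=> mY.
pose pattern w : {ffun 'I_n -> bool * bool} :=
  [ffun i => (0 < Y w 0 i, Y w 0 i < 0)].
pose dec (p : {ffun 'I_n -> bool * bool}) : 'rV[R]_n :=
  \row_i if (p i).1 then 1 else if (p i).2 then -1 else 0.
have -> : (fun w => signv (Y w)) = dec \o pattern.
  apply/funext => w; apply/rowP => i; rewrite !mxE ffunE/=.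
  by case: sgrP.
apply: finitely_valued_comp; apply: finitely_valued_finType => p.
have -> : pattern @^-1` [set p] = \bigcap_(i in [set: 'I_n])
    ([set w | (0 < Y w 0 i) = (p i).1] `&` [set w | (Y w 0 i < 0) = (p i).2]).
  apply/seteqP; split=> [w /= <- i _/=|w /= wp].
    by rewrite ffunE.
  apply/ffunP => i; rewrite ffunE; have [/= -> ->] := wp i I.
  by case: (p i).
apply: fin_bigcap_measurable => // i _; apply: measurableI.
- have m : measurable_fun setT (fun w => 0 < Y w 0 i).
    exact: measurable_fun_ltr.
  by have := m measurableT [set (p i).1] I; rewrite setTI.
- have m : measurable_fun setT (fun w => Y w 0 i < 0).
    exact: measurable_fun_ltr.
  by have := m measurableT [set (p i).2] I; rewrite setTI.
Qed.

Lemma finitely_valued_cst {S : eqType} (a : S) :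
  finitely_valued (fun _ : T => a).
Proof.
split=> [|b].
  (* The value must be attained, so an inhabitant of the domain is supplied. *)
  by exists [:: a] => b; rewrite inE; split=> [/eqP->|[_ ->]//]; exists point.
have [->|ab] := eqVneq a b.
  by rewrite (_ : _ @^-1` _ = setT)//; apply/seteqP; split.
rewrite (_ : _ @^-1` _ = set0)//; apply/seteqP; split=> // w /= /eqP.
by rewrite (negbTE ab).
Qed.

End FinitelyValued.

(** * The past of the sample sequence and conditioning on it *)

Section History.
Context {R : realType} {dO dX : measure_display}.
Context {Omega : measurableType dO} {Xi : measurableType dX}.
Variables (P : probability Omega R) (mu : probability Xi R).
Variable xi : nat -> Omega -> Xi.

(** A pi-system generating the sigma-algebra of samples 0, ..., n - 1; closure under intersection is
    what [history_indep] relies on. *)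
Definition cylinder (n : nat) : set (set Omega) :=
  [set C | exists2 A : nat -> set Xi, (forall k, measurable (A k)) &
     C = \bigcap_(k in [set` iota 0 n]) (xi k @^-1` A k)].

(** A second measurable structure on [Omega], which makes dependence on the past plain measurability
    on [history n]; [xi n] is the first sample outside it. *)
Definition history (n : nat) := g_sigma_algebraType (cylinder n).

Lemma set_iota0E n k : [set` iota 0 n] k = (k < n)%N.
Proof. by rewrite /mkset mem_iota. Qed.

Lemma cylinderS n : cylinder n `<=` cylinder n.+1.
Proof.
move=> _ [A mA ->]; exists (fun k => if (k < n)%N then A k else setT).
  by move=> k; case: ifP.
apply/seteqP; split=> w wA k; rewrite set_iota0E => kn.
  by rewrite /preimage/=; case: ifPn => // kn'; apply: wA; rewrite set_iota0E.
by have := wA k; rewrite set_iota0E /preimage/= kn; apply; rewrite ltnS ltnW.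
Qed.

Lemma measurable_historyS n d' (T' : measurableType d') (Y : Omega -> T') :
  measurable_fun [set: history n] Y -> measurable_fun [set: history n.+1] Y.
Proof.
move=> mY _ B mB; have := mY measurableT B mB.
exact: sub_sigma_algebra2 (@cylinderS n) _.
Qed.

Lemma finitely_valued_historyS n {S : eqType} (X : Omega -> S) :
  finitely_valued (X : history n -> S) ->
  finitely_valued (X : history n.+1 -> S).
Proof.
move=> [s mX]; split=> // a.
exact: sub_sigma_algebra2 (@cylinderS n) _ (mX a).
Qed.

Lemma measurable_sample n : measurable_fun [set: history n.+1] (xi n).
Proof.
move=> _ B mB; rewrite setTI; apply: sub_sigma_algebra.
exists (fun k => if k == n then B else setT); first by move=> k; case: ifP.
apply/seteqP; split=> w wB.
  by move=> k _; rewrite /preimage/=; case: eqP => // ->.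
by have := wB n; rewrite set_iota0E /preimage/= eqxx; exact.
Qed.

Hypothesis iid : iid_seq P mu xi.

Lemma history_measurable n (E : set Omega) :
  measurable (E : set (history n)) -> measurable E.
Proof.
case: iid => mxi _; apply: smallest_sub; first exact: sigma_algebra_measurable.
move=> _ [A mA ->]; apply: fin_bigcap_measurable => // k _.
by rewrite -[X in measurable X]setTI; exact: mxi.
Qed.

Lemma history_measurable_fun n d' (T' : measurableType d') (Y : Omega -> T') :
  measurable_fun [set: history n] Y -> measurable_fun [set: Omega] Y.
Proof. by move=> mY _ B mB; apply: (@history_measurable n); exact: mY. Qed.

(** As functions of [E], both sides are finite measures: a restriction of [P] and a multiple of [P].
    They agree on cylinders, hence on the generated sigma-algebra. *)
Lemma history_indep n (E : set Omega) (B : set Xi) :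
  measurable (E : set (history n)) -> measurable B ->
  P (E `&` xi n @^-1` B) = (P E * mu B)%E.
Proof.
case: (iid) => mxi [Pxi indep] mE mB.
have mxB : measurable (xi n @^-1` B).
  by rewrite -[X in measurable X]setTI; exact: mxi.
have muB : mu B = (fine (mu B))%:E by rewrite fineK// fin_num_measure.
have B0 : 0 <= fine (mu B) by rewrite fine_ge0.
rewrite -[LHS]/(mrestr P mxB E) muB muleC.
rewrite -[RHS]/(mscale (NngNum B0) P E).
apply: (g_sigma_algebra_measure_unique (cylinder n) _ (fun=> setT)) mE.
- by move=> A cA; apply: (@history_measurable n); exact: sub_sigma_algebra.
- move=> _; exists (fun=> setT) => //.
  by apply/seteqP; split.
- by apply/seteqP; split=> // w _; exists 0%N.
- move=> _ _ [A mA ->] [A' mA' ->].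
  exists (fun k => A k `&` A' k); first by move=> k; exact: measurableI.
  by rewrite -bigcapI.
- move=> _ [A mA ->]; rewrite /= /mrestr /mscale/= -muB muleC.
  (* With [B] placed at position n, the intersection becomes a cylinder over the list n :: iota 0 n,
     to which the product rule applies. *)
  pose A' k := if k == n then B else A k.
  have mA' k : measurable (A' k) by rewrite /A'; case: ifP.
  have AA' : forall k, k \in iota 0 n -> A' k = A k.
    by move=> k; rewrite mem_iota /A' => /andP[_ kn]; rewrite ltn_eqF.
  have -> : (\bigcap_(k in [set` iota 0 n]) (xi k @^-1` A k)) `&`
      xi n @^-1` B = \bigcap_(k in [set` n :: iota 0 n]) (xi k @^-1` A' k).
    apply/seteqP; split=> w.
      move=> [wA wB] k; rewrite /preimage/= inE => /predU1P[->|ks].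
        by rewrite /A' eqxx.
      by rewrite AA'//; exact: wA.
    move=> wA; split=> [k ks|].
      by rewrite /= -AA'//; apply: wA; rewrite /= inE ks orbT.
    by have := wA n; rewrite /preimage/A'/= eqxx inE eqxx; exact.
  rewrite (indep (n :: iota 0 n))//; last first.
    by rewrite /= iota_uniq mem_iota/= add0n ltnn.
  rewrite big_cons Pxi// {1}/A' eqxx muleC; congr (_ * _)%E.
  rewrite indep ?iota_uniq//; apply: eq_big_seq => k /AA' ->//.
- by move=> _; rewrite /= /mrestr setTI -ge0_fin_numE// fin_num_measure.
Qed.

(* This is E[Y phi(X, xi_n)] = E[Y cond(X)]. Since [X] has finitely many values,
   joint measurability of [phi] is not needed. *)
Lemma integral_freeze n {S : eqType} (X : Omega -> S) (Y : Omega -> R)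
  (phi : S -> Xi -> R) (cond : S -> R) :
  finitely_valued (X : history n -> S) ->
  measurable_fun [set: history n] Y ->
  P.-integrable [set: Omega] (EFin \o Y) ->
  (forall w, mu.-integrable [set: Xi] (EFin \o phi (X w))) ->
  (forall w, \int[mu]_z (phi (X w) z)%:E = (cond (X w))%:E)%E ->
  P.-integrable [set: Omega] (EFin \o (fun w => Y w * phi (X w) (xi n w))) /\
  (\int[P]_w (Y w * phi (X w) (xi n w))%:E = \int[P]_w (Y w * cond (X w))%:E)%E.
Proof.
case: (iid) => mxi _ [[s sP] mX] mY iY iphi phiE.
(* On the event X = a the integrand is the fixed function [phi a] of the fresh sample, and [Z a]
   depends on the past only, so the product formula applies value by value. *)
pose Z a w := \1_(X @^-1` [set a]) w * Y w.
have mi a : measurable_fun [set: history n] (\1_(X @^-1` [set a]) : _ -> R).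
  exact: measurable_indic.
have mZ a : measurable_fun [set: history n] (Z a).
  exact: measurable_funM.
have iZ a : P.-integrable [set: Omega] (EFin \o Z a).
  apply: le_integrable iY => //.
    by apply/measurable_EFinP; exact: history_measurable_fun (mZ a).
  move=> w _; rewrite /= lee_fin normrM ler_piMl//.
  by rewrite indicE; case: (_ \in _); rewrite ?normr1 ?normr0.
have indepZ a A B : measurable A -> measurable B ->
    P (Z a @^-1` A `&` xi n @^-1` B) = (P (Z a @^-1` A) * mu B)%E.
  move=> mA mB; apply: history_indep => //.
  by have := mZ a measurableT A mA; rewrite setTI.
have mZ' a := history_measurable_fun _ _ _ _ (mZ a).
have iphis a : a \in s -> mu.-integrable [set: Xi] (EFin \o phi a).
  by move=> /sP[w <-].
(* Integrability of [phi a] is known for attained [a] only, while the sum lemmas ask for it at every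
   index; hence the default 0. *)
pose term a w := if a \in s then Z a w * phi a (xi n w) else 0.
have iterm a : P.-integrable [set: Omega] (EFin \o term a).
  have [as_|/negbTE as_] := boolP (a \in s); rewrite /term as_; last first.
    exact: finite_measure_integrable_cst.
  by apply: (integrable_indepM P mu) => //; [exact: indepZ|exact: iphis].
have sumE w : (Y w * phi (X w) (xi n w))%:E =
    (\sum_(a <- undup s) (term a w)%:E)%E.
  rewrite (finitely_valued_sum X s (fun a w => Y w * phi a (xi n w)) sP).
  rewrite -sumEFin; apply: eq_big_seq => a; rewrite mem_undup /term => ->.
  by rewrite /Z mulrA.
have sumE' w : (Y w * cond (X w))%:E =
    (\sum_(a <- undup s) (cond a)%:E * (Z a w)%:E)%E.
  rewrite (finitely_valued_sum X s (fun a w => Y w * cond a) sP).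
  by rewrite -sumEFin; apply: eq_bigr => a _; rewrite /Z mulrA mulrC.
split.
  rewrite /comp (funext sumE).
  apply: (@integrable_sum _ _ _ _ _ measurableT _ _ xpredT
    (fun a w => (term a w)%:E)) => a _; exact: iterm.
rewrite (funext sumE) (funext sumE').
rewrite (@integral_sum _ _ _ P _ measurableT _
  (fun a w => (term a w)%:E)); last by move=> a; exact: iterm.
rewrite (@integral_sum _ _ _ P _ measurableT _
  (fun a w => (cond a)%:E * (Z a w)%:E)%E)//; last first.
  by move=> a; exact: (integrableZl measurableT (cond a) (iZ a)).
apply: eq_big_seq => a; rewrite mem_undup => as_.
rewrite integralZl//; last exact: iZ.
have [w Xw] := (sP a).1 as_.
under eq_integral do rewrite /term as_.
apply: (integral_indepM P mu) => //; [exact: indepZ|exact: iphis|].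
by rewrite -Xw.
Qed.

Lemma measurable_freeze n {S : eqType} (X : Omega -> S) (phi : S -> Xi -> R) :
  finitely_valued (X : history n -> S) ->
  (forall a, measurable_fun setT (phi a)) ->
  measurable_fun [set: history n.+1] (fun w => phi (X w) (xi n w)).
Proof.
move=> /finitely_valued_historyS fX mphi.
apply: (@measurable_finitely_valued _ (history n.+1) R _ X
  (fun a w => phi a (xi n w))) => // a.
exact: measurableT_comp (mphi a) (measurable_sample n).
Qed.

Lemma ge0_integral_freeze_le n {S : eqType} (X : Omega -> S)
  (phi : S -> Xi -> R) (c : R) :
  finitely_valued (X : history n -> S) ->
  (forall a, measurable_fun setT (phi a)) -> (forall a z, 0 <= phi a z) ->
  (forall w, \int[mu]_z (phi (X w) z)%:E <= c%:E)%E ->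
  (\int[P]_w (phi (X w) (xi n w))%:E <= c%:E)%E.
Proof.
move=> fX mphi phi0 phic.
have iphi w : mu.-integrable [set: Xi] (EFin \o phi (X w)).
  exact: ge0_integrable _ _ _ (mphi _) (phi0 _) (phic w).
(* At values that [X] does not attain the integral may be infinite and [fine] returns 0; [condE]
   concerns attained values. *)
pose cond a := fine (\int[mu]_z (phi a z)%:E)%E.
have condE w : (\int[mu]_z (phi (X w) z)%:E = (cond (X w))%:E)%E.
  by rewrite fineK//; exact: integrable_fin_num (iphi w).
have [||_] := integral_freeze n X (cst 1) phi cond fX _ _ iphi condE.
- exact: measurable_cst.
- exact: finite_measure_integrable_cst.
under eq_integral do rewrite mul1r.
move=> ->; rewrite -[leRHS](integral_prob_cst P); apply: ge0_le_integral => //=.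
- by move=> w _; rewrite mul1r lee_fin fine_ge0// integral_ge0// => z _; rewrite lee_fin.
- apply/measurable_EFinP; apply: (@history_measurable_fun n).
  exact: (@measurable_finitely_valued _ (history n) R _ X
    (fun a _ => 1 * cond a)).
- by move=> w _; rewrite mul1r -condE.
Qed.

Context {dim : nat}.

Lemma measurable_sqr_norm2 {d} {T : measurableType d} (Y : T -> 'rV[R]_dim) :
  (forall i, measurable_fun setT (fun w => Y w 0 i)) ->
  measurable_fun setT (fun w => norm2 (Y w) ^+ 2).
Proof.
move=> mY; under eq_fun do rewrite sqr_norm2.
by apply: measurable_sum => i; exact: measurable_funX.
Qed.

(* Orthogonality of martingale increments. *)
Lemma integral_sqr_norm2_step n {S : eqType} (X : Omega -> S)
  (Y : Omega -> 'rV[R]_dim) (zeta : S -> Xi -> 'rV[R]_dim) (a r c : R) :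
  finitely_valued (X : history n -> S) ->
  (forall i, measurable_fun [set: history n] (fun w => Y w 0 i)) ->
  (forall s i, measurable_fun setT (fun z => zeta s z 0 i)) ->
  (forall s i, mu.-integrable setT (fun z => (zeta s z 0 i)%:E)) ->
  (forall s i, \int[mu]_z (zeta s z 0 i)%:E = 0)%E ->
  (\int[P]_w (norm2 (Y w) ^+ 2)%:E <= r%:E)%E ->
  (forall w, \int[mu]_z (norm2 (zeta (X w) z) ^+ 2)%:E <= c%:E)%E ->
  (\int[P]_w (norm2 (a *: Y w + zeta (X w) (xi n w)) ^+ 2)%:E <=
   (a ^+ 2 * r + c)%:E)%E.
Proof.
move=> fX mY mzeta izeta zeta0 Yr zetac.
have mYP i : measurable_fun [set: Omega] (fun w => Y w 0 i).
  exact: (@history_measurable_fun n).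
have mZ i : measurable_fun [set: Omega] (fun w => zeta (X w) (xi n w) 0 i).
  apply: (@history_measurable_fun n.+1).
  exact: (measurable_freeze n X (fun s z => zeta s z 0 i)).
have mY2 := measurable_sqr_norm2 _ mYP.
have mZ2 := measurable_sqr_norm2 _ mZ.
have iY2 := ge0_integrable P _ _ mY2 (fun w => sqr_norm2_ge0 _) Yr.
(* Domination by |Y_i| <= 1 + |Y|^2. *)
have iY i : P.-integrable [set: Omega] (EFin \o (fun w => Y w 0 i)).
  apply: (@le_integrable _ _ _ P _ measurableT _
    (fun w => (1 + norm2 (Y w) ^+ 2)%:E)).
  - exact/measurable_EFinP.
  - move=> w _; rewrite /= lee_fin [leRHS]ger0_norm; last first.
      by rewrite addr_ge0// sqr_norm2_ge0.
    have : `|Y w 0 i| ^+ 2 <= norm2 (Y w) ^+ 2.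
      rewrite sqr_norm2 (bigD1 i)//= real_normK ?num_real// lerDl.
      by rewrite sumr_ge0// => j _; exact: sqr_ge0.
    have := sqr_ge0 (`|Y w 0 i| - 1); nra.
  - have := integrableD measurableT
      (finite_measure_integrable_cst P 1 measurableT) iY2.
    by apply: eq_integrable.
(* The fresh increment has conditional mean 0, so each cross term integrates to 0. *)
have cross i : P.-integrable [set: Omega]
    (EFin \o (fun w => Y w 0 i * zeta (X w) (xi n w) 0 i)) /\
    (\int[P]_w (Y w 0 i * zeta (X w) (xi n w) 0 i)%:E = 0)%E.
  have [|iZ ->] := integral_freeze n X (fun w => Y w 0 i)
    (fun s z => zeta s z 0 i) (fun=> 0) fX (mY i) (iY i)
    (fun w => izeta (X w) i); first by move=> w; exact: zeta0.
  by split=> //; under eq_integral do rewrite mulr0; rewrite integral0.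
have Zc : (\int[P]_w (norm2 (zeta (X w) (xi n w)) ^+ 2)%:E <= c%:E)%E.
  apply: (ge0_integral_freeze_le n X (fun s z => norm2 (zeta s z) ^+ 2)) => //.
  - by move=> s; exact: measurable_sqr_norm2.
  - by move=> s z; exact: sqr_norm2_ge0.
(* The expanded square is split into the signed cross terms [B], of integral 0, and the nonnegative
   squares [A]. *)
pose B w := \sum_(i < dim) (2 * a) * (Y w 0 i * zeta (X w) (xi n w) 0 i).
pose A w := a ^+ 2 * norm2 (Y w) ^+ 2 + norm2 (zeta (X w) (xi n w)) ^+ 2.
have A0 w : 0 <= A w.
  by rewrite addr_ge0 ?sqr_norm2_ge0// mulr_ge0 ?sqr_norm2_ge0 ?sqr_ge0.
have mA : measurable_fun [set: Omega] A.
  by apply: measurable_funD => //; exact: measurable_funM.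
have Ar : (\int[P]_w (A w)%:E <= (a ^+ 2 * r + c)%:E)%E.
  rewrite -[c]mul1r -[a ^+ 2 * r + _]addr0.
  apply: (ge0_integral_le_comb P A _ _ _ _ _ _ _ mA mY2 mZ2) => //.
  - by move=> w; exact: sqr_norm2_ge0.
  - by move=> w; exact: sqr_norm2_ge0.
  - exact: sqr_ge0.
  - by move=> w; rewrite mul1r addr0.
have iA := ge0_integrable P _ _ mA A0 Ar.
have BE w : (B w)%:E = (\sum_(i < dim) (2 * a)%:E *
    (Y w 0 i * zeta (X w) (xi n w) 0 i)%:E)%E.
  by rewrite /B -sumEFin.
have icross i : P.-integrable [set: Omega]
    (fun w => (2 * a)%:E * (Y w 0 i * zeta (X w) (xi n w) 0 i)%:E)%E.
  exact: integrableZl (cross i).1.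
have iB : P.-integrable [set: Omega] (EFin \o B).
  rewrite /comp (funext BE).
  by apply: (@integrable_sum _ _ _ P _ measurableT _ _ xpredT
    (fun i w => (2 * a)%:E * (Y w 0 i * zeta (X w) (xi n w) 0 i)%:E)%E).
have B0 : (\int[P]_w (B w)%:E = 0)%E.
  rewrite (funext BE) (@integral_sum _ _ _ P _ measurableT _
    (fun i w => (2 * a)%:E * (Y w 0 i * zeta (X w) (xi n w) 0 i)%:E)%E)//.
  rewrite big1// => i _; rewrite integralZl//; last exact: (cross i).1.
  by rewrite (cross i).2 mule0.
have AB w : norm2 (a *: Y w + zeta (X w) (xi n w)) ^+ 2 = A w + B w.
  rewrite /A /B !sqr_norm2 mulr_sumr -!big_split/=; apply: eq_bigr => i _.
  by rewrite !mxE; ring.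
under eq_integral do rewrite AB.
rewrite -[X in (X <= _)%E]/(\int[P]_w (((EFin \o A) \+ (EFin \o B)) w))%E.
by rewrite integralD_EFin// [X in (_ + X)%E]B0 adde0.
Qed.

End History.

(** * Jensen's inequality for squares, and affine combinations of means *)

Section Means.
Context {R : realType} {d : measure_display} {T : measurableType d}.
Variable P : probability T R.

(** Integrate 2 c V <= V^2 + c^2, that is (V - c)^2 >= 0. If the second moment is infinite the claim
    is trivial. *)
Lemma sqr_mean_le (V : T -> R) (c : R) : P.-integrable setT (EFin \o V) ->
  (\int[P]_w (V w)%:E = c%:E)%E -> ((c ^+ 2)%:E <= \int[P]_w (V w ^+ 2)%:E)%E.
Proof.
move=> iV Vc.
have mV : measurable_fun setT V.
  by apply/measurable_EFinP; exact: measurable_int iV.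
have V20 : (0 <= \int[P]_w (V w ^+ 2)%:E)%E.
  by apply: integral_ge0 => w _; rewrite lee_fin sqr_ge0.
have [oo|Vlt] := leP +oo%E (\int[P]_w (V w ^+ 2)%:E)%E.
  by apply: le_trans oo; exact: leey.
have V2E : (\int[P]_w (V w ^+ 2)%:E = (fine (\int[P]_w (V w ^+ 2)%:E))%:E)%E.
  by rewrite fineK// ge0_fin_numE.
have iV2 : P.-integrable setT (EFin \o (fun w => V w ^+ 2)).
  apply: (ge0_integrable P _ (fine (\int[P]_w (V w ^+ 2)%:E)%E)) => //.
  - exact: measurable_funX.
  - by move=> w; exact: sqr_ge0.
  - by rewrite -V2E.
have ic : P.-integrable setT (EFin \o cst (c ^+ 2)).
  exact: finite_measure_integrable_cst.
have i2cV := integrableZl measurableT (2 * c) iV.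
have iD := integrableD measurableT iV2 ic.
have := le_integral measurableT i2cV iD.
rewrite integralZl// Vc integralD_EFin//= [X in (_ + X)%E]integral_prob_cst.
rewrite V2E -EFinM -EFinD !lee_fin => H.
suff : 2 * c * c <= fine (\int[P]_w (V w ^+ 2)%:E)%E + c ^+ 2 by lra.
apply: H => w _; rewrite /= -EFinM -EFinD lee_fin.
by have := sqr_ge0 (V w - c); lra.
Qed.

Lemma integral_affine2 (V W : T -> R) (v w p q k : R) :
  P.-integrable setT (EFin \o V) -> (\int[P]_x (V x)%:E = v%:E)%E ->
  P.-integrable setT (EFin \o W) -> (\int[P]_x (W x)%:E = w%:E)%E ->
  P.-integrable setT (fun x => (p * V x + q * W x + k)%:E) /\
  (\int[P]_x (p * V x + q * W x + k)%:E = (p * v + q * w + k)%:E)%E.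
Proof.
move=> iV Vv iW Ww.
have ipV := integrableZl measurableT p iV.
have iqW := integrableZl measurableT q iW.
have ic : P.-integrable setT (EFin \o cst k).
  exact: finite_measure_integrable_cst.
have E x : (p * V x + q * W x + k)%:E =
  (((fun x => p%:E * (EFin \o V) x) \+ (fun x => q%:E * (EFin \o W) x)) x +
   (EFin \o cst k) x)%E by rewrite /= !EFinD !EFinM.
rewrite (funext E); split.
  by apply: integrableD => //; exact: integrableD.
rewrite integralD//; last exact: integrableD.
rewrite [X in (X + _)%E]integralD// !integralZl// Vv Ww.
by rewrite [X in (_ + X)%E]integral_prob_cst !EFinD !EFinM.
Qed.

End Means.

(** * Lion-VR trajectories: regularity and dependence on the past *)

Section Lion.
Context {R : realType} {dO dX : measure_display}.
Context {Omega : measurableType dO} {Xi : measurableType dX} {d : nat}.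
Variables (P : probability Omega R) (mu : probability Xi R).
Variables (xi : nat -> Omega -> Xi) (G : 'rV[R]_d -> Xi -> 'rV[R]_d).
Variables (gradf : 'rV[R]_d -> 'rV[R]_d) (L sigma : R).
Hypothesis mG : forall x i, measurable_fun setT (fun z => G x z 0 i).
Hypothesis smooth : forall x y,
  (\int[mu]_z ((norm2 (G x z - G y z)) ^+ 2)%:E <=
     (L ^+ 2 * (norm2 (x - y)) ^+ 2)%:E)%E.
Hypothesis unbiased : forall x i,
  mu.-integrable setT (fun z => (G x z 0 i)%:E) /\
  (\int[mu]_z (G x z 0 i)%:E = (gradf x 0 i)%:E)%E.
Hypothesis noise : forall x,
  (\int[mu]_z ((norm2 (G x z - gradf x)) ^+ 2)%:E <= (sigma ^+ 2)%:E)%E.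
Hypothesis iid : iid_seq P mu xi.

(** Jensen in each coordinate: a gradient difference is the mean of the oracle differences, so
    mean-squared smoothness passes to it. *)
Lemma gradf_lipschitz x y :
  norm2 (gradf x - gradf y) ^+ 2 <= L ^+ 2 * norm2 (x - y) ^+ 2.
Proof.
rewrite -lee_fin; apply: le_trans (smooth x y).
have E z : (norm2 (G x z - G y z) ^+ 2)%:E =
    (\sum_(i < d) ((G x z - G y z) 0 i ^+ 2)%:E)%E.
  by rewrite sqr_norm2 -sumEFin.
rewrite (funext E) ge0_integral_sum//; last 2 first.
- move=> i; apply/measurable_EFinP/measurable_funX.
  by under eq_fun do rewrite !mxE; exact: measurable_funB.
- by move=> i z _; rewrite lee_fin sqr_ge0.
rewrite sqr_norm2 -sumEFin; apply: lee_sum => i _.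
have [iV Vm] := integral_affine2 mu _ _ _ _ 1 (-1) 0
  (unbiased x i).1 (unbiased x i).2 (unbiased y i).1 (unbiased y i).2.
have VE z : (G x z - G y z) 0 i = 1 * G x z 0 i + -1 * G y z 0 i + 0.
  by rewrite !mxE; ring.
apply: (sqr_mean_le mu).
  by rewrite /comp; under eq_fun do rewrite VE.
under eq_integral do rewrite VE.
by rewrite Vm; congr EFin; rewrite !mxE; ring.
Qed.

Lemma measurable_oracle_noise x :
  measurable_fun setT (fun z => norm2 (G x z - gradf x) ^+ 2).
Proof.
apply: measurable_sqr_norm2 => i; under eq_fun do rewrite !mxE.
exact: measurable_funB.
Qed.

Lemma measurable_oracle_diff x y :
  measurable_fun setT (fun z => norm2 (G x z - G y z) ^+ 2).
Proof.
apply: measurable_sqr_norm2 => i; under eq_fun do rewrite !mxE.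
exact: measurable_funB.
Qed.

(** The orthogonality step with contraction factor 1 and a trivial frozen variable: every sample
    adds sigma^2. Measurability is proved in the same induction because that step asks for it. *)
Lemma batch_sum_le (x : 'rV[R]_d) n :
  (forall i, measurable_fun [set: history xi n]
    (fun w => (\sum_(k < n) (G x (xi k w) - gradf x)) 0 i)) /\
  (\int[P]_w (norm2 (\sum_(k < n) (G x (xi k w) - gradf x)) ^+ 2)%:E <=
    (n%:R * sigma ^+ 2)%:E)%E.
Proof.
elim: n => [|n [mS IH]].
  split=> [i|].
    by under eq_fun do rewrite big_ord0; exact: measurable_cst.
  under eq_integral do rewrite big_ord0 sqr_norm2.
  rewrite mul0r (_ : (fun=> _) = cst 0%E) ?integral0//.
  by apply/funext => w; rewrite big1// => i _; rewrite mxE expr0n.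
have mZ (s : unit) i : measurable_fun setT (fun z => (G x z - gradf x) 0 i).
  by under eq_fun do rewrite !mxE; exact: measurable_funB.
have fX : finitely_valued ((fun _ => tt) : history xi n -> unit).
  exact: finitely_valued_cst.
split=> [i|].
  under eq_fun do rewrite big_ord_recr mxE.
  apply: measurable_funD; first exact: measurable_historyS.
  exact: (measurable_freeze xi n (fun _ => tt)
    (fun (_ : unit) z => (G x z - gradf x) 0 i) fX (mZ^~ i)).
have ZE i z : (G x z - gradf x) 0 i =
    1 * G x z 0 i + 0 * G x z 0 i + - gradf x 0 i by rewrite !mxE; ring.
have Z0 i := integral_affine2 mu _ _ _ _ 1 0 (- gradf x 0 i)
  (unbiased x i).1 (unbiased x i).2 (unbiased x i).1 (unbiased x i).2.
have SE w : \sum_(k < n.+1) (G x (xi k w) - gradf x) =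
    1 *: (\sum_(k < n) (G x (xi k w) - gradf x)) + (G x (xi n w) - gradf x).
  by rewrite big_ord_recr scale1r.
under eq_integral do rewrite SE.
have -> : n.+1%:R * sigma ^+ 2 = 1 ^+ 2 * (n%:R * sigma ^+ 2) + sigma ^+ 2.
  by rewrite expr1n mul1r -natr1 mulrDl mul1r.
apply: (integral_sqr_norm2_step P mu xi iid n (fun _ => tt)
  (fun w => \sum_(k < n) (G x (xi k w) - gradf x))
  (fun (_ : unit) z => G x z - gradf x) _ _ _ fX mS mZ _ _ IH (fun=> noise x)).
- by move=> _ i; under eq_fun do rewrite ZE; exact: (Z0 i).1.
- move=> _ i; under eq_integral do rewrite ZE.
  by rewrite (Z0 i).2; congr EFin; ring.
Qed.

Variables (B0 : nat) (beta1 beta2 eta lambda : R) (x1 : 'rV[R]_d).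
Hypotheses (B0_gt0 : (0 < B0)%N).

Let st k w :=
  lion_state G B0 beta1 beta2 eta lambda x1 (fun n => xi n w) k.

(** The direction v_(k+1), which [lion_state] computes but does not store. *)
Definition lion_v (k : nat) (w : Omega) : 'rV[R]_d :=
  if k is k'.+1 then
    (1 - beta1) *: (st k' w).2 + beta1 *: G (st k' w).1.2 (xi (B0 + k') w)
  else (st 0 w).2.

Lemma lion_xS k w : (st k w).1.2 =
  (st k w).1.1 - eta *: (signv (lion_v k w) + lambda *: (st k w).1.1).
Proof.
by case: k => [//|k]; rewrite /lion_v /st/=; case: lion_state => [[]].
Qed.

Lemma lion_x_next k w : (st k.+1 w).1.1 = (st k w).1.2.
Proof. by rewrite /st/=; case: lion_state => [[]]. Qed.

Lemma lion_mS k w : (st k.+1 w).2 =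
  (1 - beta2) *: (st k w).2 + beta2 *: G (st k w).1.2 (xi (B0 + k) w) +
  (1 - beta2) *: (G (st k w).1.2 (xi (B0 + k) w) -
                  G (st k w).1.1 (xi (B0 + k) w)).
Proof. by rewrite /st/=; case: lion_state => [[]]. Qed.

(** State k has consumed samples 0, ..., B0 + k - 1. The two claims need each other: a measurable
    momentum makes the sign, hence the next iterate, finitely valued, and this makes the oracle at
    that iterate measurable. *)
Lemma lion_history k :
  finitely_valued ((fun w => (st k w).1) : history xi (B0 + k) -> _) /\
  forall i, measurable_fun [set: history xi (B0 + k)] (fun w => (st k w).2 0 i).
Proof.
have nextx k' n : finitely_valued ((fun w => (st k' w).1.1) : history xi n -> _) ->
    (forall i, measurable_fun [set: history xi n] (fun w => lion_v k' w 0 i)) ->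
    finitely_valued ((fun w => (st k' w).1) : history xi n -> _).
  move=> fx mv; have fs := finitely_valued_signv _ _ mv.
  have := finitely_valued_comp _ (fun p : 'rV[R]_d * 'rV[R]_d =>
    (p.1, p.1 - eta *: (p.2 + lambda *: p.1))) (finitely_valued_pair _ _ fx fs).
  congr (finitely_valued _); apply/funext => w /=.
  by rewrite -lion_xS; case: (st k' w).1.
elim: k => [|k [fX mm]].
  rewrite addn0; have m0 i : measurable_fun [set: history xi B0]
      (fun w => (st 0 w).2 0 i).
    rewrite /st/=; under eq_fun do rewrite mxE.
    apply: measurable_funM => //.
    have [mS _] := batch_sum_le x1 B0.
    rewrite (_ : (fun w => _) = (fun w =>
      (\sum_(k < B0) (G x1 (xi k w) - gradf x1)) 0 i + (gradf x1 *+ B0) 0 i)).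
      exact: measurable_funD.
    by apply/funext => w; rewrite sumrB sumr_const card_ord !mxE subrK.
  split=> //; apply: nextx => //.
  exact: finitely_valued_cst.
have mg i : measurable_fun [set: history xi (B0 + k).+1]
    (fun w => G (st k w).1.2 (xi (B0 + k) w) 0 i).
  exact: (measurable_freeze xi (B0 + k) (fun w => (st k w).1)
    (fun s z => G s.2 z 0 i) fX (fun s => mG s.2 i)).
have mgp i : measurable_fun [set: history xi (B0 + k).+1]
    (fun w => G (st k w).1.1 (xi (B0 + k) w) 0 i).
  exact: (measurable_freeze xi (B0 + k) (fun w => (st k w).1)
    (fun s z => G s.1 z 0 i) fX (fun s => mG s.1 i)).
have mm' i := measurable_historyS xi _ _ _ _ (mm i).
rewrite addnS; split.
  apply: nextx => [|i].
    under eq_fun do rewrite lion_x_next.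
    apply: finitely_valued_historyS.
    exact: (finitely_valued_comp _ snd fX).
  rewrite /lion_v; under eq_fun do rewrite !mxE.
  by apply: measurable_funD; exact: measurable_funM.
move=> i; under eq_fun do rewrite lion_mS !mxE.
apply: measurable_funD; first by apply: measurable_funD; exact: measurable_funM.
by apply: measurable_funM => //; exact: measurable_funB.
Qed.

Lemma initial_error_le :
  (\int[P]_w (norm2 ((st 0 w).2 - gradf x1) ^+ 2)%:E <=
    (sigma ^+ 2 / B0%:R)%:E)%E.
Proof.
have [mS Sle] := batch_sum_le x1 B0.
have B0r : B0%:R != 0 :> R by rewrite pnatr_eq0 -lt0n.
have E w : (norm2 ((st 0 w).2 - gradf x1) ^+ 2)%:E = ((B0%:R^-1 ^+ 2)%:E *
    (norm2 (\sum_(k < B0) (G x1 (xi k w) - gradf x1)) ^+ 2)%:E)%E.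
  rewrite -EFinM -sqr_norm2Z; congr (norm2 _ ^+ 2)%:E.
  rewrite sumrB sumr_const card_ord scalerBr -[gradf x1 *+ B0]scaler_nat scalerA.
  by rewrite mulVf// scale1r.
rewrite (funext E) ge0_integralZl_EFin; last 4 first.
- exact: measurableT.
- by move=> w _; rewrite lee_fin sqr_norm2_ge0.
- apply/measurable_EFinP/measurable_sqr_norm2 => i.
  exact: (history_measurable_fun P mu xi iid B0).
- exact: sqr_ge0.
apply: (@le_trans _ _ ((B0%:R^-1 ^+ 2)%:E * (B0%:R * sigma ^+ 2)%:E)%E).
  by rewrite lee_wpmul2l// lee_fin sqr_ge0.
by rewrite -EFinM lee_fin le_eqVlt; apply/orP; left; apply/eqP; field.
Qed.

(** * Mean-squared errors of the momentum and of the direction *)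

Variables (D : R) (T : nat).
Hypothesis beta2_01 : 0 <= beta2 <= 1.
Hypothesis D0 : 0 <= D.
Hypothesis stepD : forall k w, (k < T)%N ->
  norm2 ((st k w).1.2 - (st k w).1.1) ^+ 2 <= D.

Definition error_bound (k : nat) : R :=
  iter k (fun r => (1 - beta2) ^+ 2 * r +
            (2 * beta2 ^+ 2 * sigma ^+ 2 + 8 * L ^+ 2 * D))
    (sigma ^+ 2 / B0%:R).

Arguments error_bound : simpl never.

(** The fresh part of the momentum error at a frozen pair (previous iterate, current iterate). It is
    centred because the correction term of the momentum tracks the change of the gradient in
    mean. *)
Let zeta (s : 'rV[R]_d * 'rV[R]_d) z :=
  beta2 *: (G s.2 z - gradf s.2) +
  (1 - beta2) *: ((G s.2 z - G s.1 z) - (gradf s.2 - gradf s.1)).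

Let zetaE s z i : zeta s z 0 i = 1 * G s.2 z 0 i + (beta2 - 1) * G s.1 z 0 i +
  ((1 - beta2) * gradf s.1 0 i - gradf s.2 0 i).
Proof. by rewrite !mxE; ring. Qed.

Let zeta_mean s i : mu.-integrable setT (fun z => (zeta s z 0 i)%:E) /\
  (\int[mu]_z (zeta s z 0 i)%:E = 0)%E.
Proof.
have [iz zE] := integral_affine2 mu _ _ _ _ 1 (beta2 - 1)
  ((1 - beta2) * gradf s.1 0 i - gradf s.2 0 i)
  (unbiased s.2 i).1 (unbiased s.2 i).2 (unbiased s.1 i).1 (unbiased s.1 i).2.
split; first by under eq_fun do rewrite zetaE.
by under eq_integral do rewrite zetaE; rewrite zE; congr EFin; ring.
Qed.

Let mzeta s i : measurable_fun setT (fun z => zeta s z 0 i).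
Proof. by apply/measurable_EFinP; exact: measurable_int (zeta_mean s i).1. Qed.

(** Two successive uses of |u + v|^2 <= 2 |u|^2 + 2 |v|^2. The constant 8 is 4 from the oracle
    difference plus 4 from the gradient difference, the latter bounded pointwise. *)
Let zeta_var s : norm2 (s.2 - s.1) ^+ 2 <= D ->
  (\int[mu]_z (norm2 (zeta s z) ^+ 2)%:E <=
    (2 * beta2 ^+ 2 * sigma ^+ 2 + 8 * L ^+ 2 * D)%:E)%E.
Proof.
move=> sD; have /andP[b0 b1] := beta2_01.
have lipD : L ^+ 2 * norm2 (s.2 - s.1) ^+ 2 <= L ^+ 2 * D.
  by rewrite ler_wpM2l ?sqr_ge0.
have gD := le_trans (gradf_lipschitz s.2 s.1) lipD.
have GD : (\int[mu]_z (norm2 (G s.2 z - G s.1 z) ^+ 2)%:E <= (L ^+ 2 * D)%:E)%E.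
  by apply: le_trans (smooth s.2 s.1) _; rewrite lee_fin.
have := ge0_integral_le_comb mu _ _ _ (2 * beta2 ^+ 2) 4 (4 * (L ^+ 2 * D)) _ _
  (measurable_sqr_norm2 _ (mzeta s)) (measurable_oracle_noise s.2)
  (measurable_oracle_diff s.2 s.1) (fun=> sqr_norm2_ge0 _)
  (fun=> sqr_norm2_ge0 _) (fun=> sqr_norm2_ge0 _) _ _ _ _ (noise s.2) GD.
have -> : 2 * beta2 ^+ 2 * sigma ^+ 2 + 4 * (L ^+ 2 * D) + 4 * (L ^+ 2 * D) =
  2 * beta2 ^+ 2 * sigma ^+ 2 + 8 * L ^+ 2 * D by ring.
have LD0 : 0 <= L ^+ 2 * D by rewrite mulr_ge0 ?sqr_ge0.
apply => //; first by rewrite mulr_ge0// sqr_ge0.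
  by rewrite mulr_ge0.
move=> z; apply: le_trans (sqr_norm2D_le _ _) _; rewrite !sqr_norm2Z -[leRHS]addrA.
apply: lerD; first by rewrite mulrA.
have := sqr_norm2D_le (G s.2 z - G s.1 z) (- (gradf s.2 - gradf s.1)).
rewrite sqr_norm2N; set a := norm2 _ ^+ 2; set b := norm2 _ ^+ 2 => H.
have a0 : 0 <= a by exact: sqr_norm2_ge0.
have q1 : (1 - beta2) ^+ 2 <= 1 by rewrite expr_le1//; lra.
have : (1 - beta2) ^+ 2 * a <= a by rewrite ler_piMl.
move: gD; rewrite -/b; lra.
Qed.

Lemma lion_error_le k : (k <= T)%N ->
  (\int[P]_w (norm2 ((st k w).2 - gradf (st k w).1.1) ^+ 2)%:E <=
    (error_bound k)%:E)%E.
Proof.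
elim: k => [_|k IH kT].
  exact: initial_error_le.
have [fX mm] := lion_history k.
have errE w : (st k.+1 w).2 - gradf (st k.+1 w).1.1 =
    (1 - beta2) *: ((st k w).2 - gradf (st k w).1.1) +
    zeta (st k w).1 (xi (B0 + k) w).
  by rewrite lion_mS lion_x_next; apply/rowP => i; rewrite !mxE; ring.
under eq_integral do rewrite errE.
apply: (integral_sqr_norm2_step P mu xi iid (B0 + k) (fun w => (st k w).1)
  (fun w => (st k w).2 - gradf (st k w).1.1) zeta _ _ _ fX).
- move=> i; under eq_fun do rewrite !mxE.
  apply: measurable_funB => //.
  exact: (@measurable_finitely_valued _ (history xi (B0 + k)) R _
    (fun w => (st k w).1) (fun s _ => gradf s.1 0 i)).
- exact: mzeta.
- by move=> s i; have [] := zeta_mean s i.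
- by move=> s i; have [] := zeta_mean s i.
- exact: IH (ltnW kT).
- by move=> w; apply: zeta_var; exact: stepD.
Qed.

(** v_(k+1) mixes the previous momentum with a fresh gradient and has no correction term, so the
    drift of the gradient over one step remains; the factor 3 comes from squaring a sum of three
    terms. The first direction is the batch mean itself. *)
Definition direction_bound (k : nat) : R :=
  if k is k'.+1 then
    3 * error_bound k' + 3 * beta1 ^+ 2 * sigma ^+ 2 + 3 * L ^+ 2 * D
  else error_bound 0.

(** Any function of a finitely valued variable is measurable; this is applied to [norm1] of the
    gradient and to its coordinates. *)
Lemma measurable_x_fun k (h : 'rV[R]_d -> R) :
  measurable_fun [set: Omega] (fun w => h (st k w).1.1).
Proof.
have [fX _] := lion_history k.
apply: (history_measurable_fun P mu xi iid (B0 + k)).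
exact: (@measurable_finitely_valued _ (history xi (B0 + k)) R _
  (fun w => (st k w).1) (fun s _ => h s.1)).
Qed.

Lemma measurable_momentum k i :
  measurable_fun [set: Omega] (fun w => (st k w).2 0 i).
Proof.
have [_ mm] := lion_history k.
exact: (history_measurable_fun P mu xi iid (B0 + k)).
Qed.

Lemma measurable_fresh_gradient k i :
  measurable_fun [set: Omega] (fun w => G (st k w).1.2 (xi (B0 + k) w) 0 i).
Proof.
have [fX _] := lion_history k.
apply: (history_measurable_fun P mu xi iid (B0 + k).+1).
exact: (measurable_freeze xi (B0 + k) (fun w => (st k w).1)
  (fun s z => G s.2 z 0 i) fX (fun s => mG s.2 i)).
Qed.

Lemma measurable_direction_error k :
  measurable_fun [set: Omega]
    (fun w => norm2 (gradf (st k w).1.1 - lion_v k w) ^+ 2).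
Proof.
apply: measurable_sqr_norm2 => i; under eq_fun do rewrite !mxE.
apply: measurable_funB; first exact: (measurable_x_fun k (fun x => gradf x 0 i)).
case: k => [|k] /=; first exact: (measurable_momentum 0).
under eq_fun do rewrite !mxE.
apply: measurable_funD; apply: measurable_funM => //.
  exact: measurable_momentum.
exact: measurable_fresh_gradient.
Qed.

Lemma direction_error_le k : 0 <= beta1 <= 1 -> (k < T)%N ->
  (\int[P]_w (norm2 (gradf (st k w).1.1 - lion_v k w) ^+ 2)%:E <=
    (direction_bound k)%:E)%E.
Proof.
move=> /andP[b0 b1]; case: k => [|k] kT.
  have E w : norm2 (gradf (st 0 w).1.1 - lion_v 0 w) ^+ 2 =
    norm2 ((st 0 w).2 - gradf x1) ^+ 2 by rewrite -sqr_norm2N opprB.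
  under eq_integral do rewrite E.
  exact: initial_error_le.
have [fX _] := lion_history k.
have mnoise : measurable_fun [set: Omega] (fun w =>
    norm2 (G (st k w).1.2 (xi (B0 + k) w) - gradf (st k w).1.2) ^+ 2).
  apply: measurable_sqr_norm2 => i; under eq_fun do rewrite !mxE.
  apply: measurable_funB; first exact: measurable_fresh_gradient.
  under eq_fun do rewrite -lion_x_next.
  exact: (measurable_x_fun k.+1 (fun x => gradf x 0 i)).
have noiseP := ge0_integral_freeze_le P mu xi iid (B0 + k) (fun w => (st k w).1)
  (fun s z => norm2 (G s.2 z - gradf s.2) ^+ 2) _ fX
  (fun s => measurable_oracle_noise s.2) (fun _ _ => sqr_norm2_ge0 _)
  (fun w => noise (st k w).1.2).
have merr : measurable_fun [set: Omega] (fun w =>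
    norm2 ((st k w).2 - gradf (st k w).1.1) ^+ 2).
  apply: measurable_sqr_norm2 => i; under eq_fun do rewrite !mxE.
  apply: measurable_funB; first exact: measurable_momentum.
  exact: (measurable_x_fun k (fun x => gradf x 0 i)).
apply: (ge0_integral_le_comb P _ _ _ 3 (3 * beta1 ^+ 2) (3 * L ^+ 2 * D) _ _
  (measurable_direction_error k.+1) merr mnoise (fun=> sqr_norm2_ge0 _)
  (fun=> sqr_norm2_ge0 _) (fun=> sqr_norm2_ge0 _) _ _ _ _
  (lion_error_le k (ltnW (ltnW kT))) noiseP) => //.
- by rewrite mulr_ge0// sqr_ge0.
- by rewrite mulr_ge0// mulr_ge0// sqr_ge0.
move=> w; rewrite lion_x_next /=.
have -> : gradf (st k w).1.2 -
    ((1 - beta1) *: (st k w).2 + beta1 *: G (st k w).1.2 (xi (B0 + k) w)) =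
    - ((1 - beta1) *: ((st k w).2 - gradf (st k w).1.1)) +
    - (beta1 *: (G (st k w).1.2 (xi (B0 + k) w) - gradf (st k w).1.2)) +
    (1 - beta1) *: (gradf (st k w).1.2 - gradf (st k w).1.1).
  by apply/rowP => i; rewrite !mxE; ring.
apply: le_trans (sqr_norm2D3_le _ _ _) _; rewrite !sqr_norm2N !sqr_norm2Z.
have lip : norm2 (gradf (st k w).1.2 - gradf (st k w).1.1) ^+ 2 <= L ^+ 2 * D.
  apply: le_trans (gradf_lipschitz _ _) _; rewrite ler_wpM2l ?sqr_ge0//.
  by apply: stepD; exact: ltnW.
have q1 : (1 - beta1) ^+ 2 <= 1 by rewrite expr_le1//; lra.
have e1 : forall a : R, 0 <= a -> (1 - beta1) ^+ 2 * a <= a.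
  by move=> a a0; rewrite ler_piMl.
have h1 := e1 _ (sqr_norm2_ge0 ((st k w).2 - gradf (st k w).1.1)).
have h2 := e1 _ (sqr_norm2_ge0 (gradf (st k w).1.2 - gradf (st k w).1.1)).
lra.
Qed.

Lemma error_boundS k : error_bound k.+1 = (1 - beta2) ^+ 2 * error_bound k +
  (2 * beta2 ^+ 2 * sigma ^+ 2 + 8 * L ^+ 2 * D).
Proof. by []. Qed.

Lemma error_bound_ge0 k : 0 <= error_bound k.
Proof.
elim: k => [|k IH]; first by rewrite /error_bound/= divr_ge0 ?sqr_ge0.
rewrite error_boundS addr_ge0//.
  by rewrite mulr_ge0 ?sqr_ge0.
by rewrite addr_ge0// mulr_ge0 ?sqr_ge0// mulr_ge0 ?sqr_ge0.
Qed.

(** As (1 - beta2)^2 <= 1 - beta2, the recursion gives beta2 e_k <= e_k - e_(k+1) + c, which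
    telescopes. *)
Lemma error_bound_sum n : beta2 * (\sum_(k < n) error_bound k) <=
  error_bound 0 - error_bound n +
  n%:R * (2 * beta2 ^+ 2 * sigma ^+ 2 + 8 * L ^+ 2 * D).
Proof.
have /andP[b0 b1] := beta2_01.
elim: n => [|n IH]; first by rewrite big_ord0 mulr0 subrr mul0r addr0.
rewrite error_boundS big_ord_recr/= mulrDr.
have := error_bound_ge0 n; move: IH.
set c := 2 * beta2 ^+ 2 * _ + _.
have -> : n.+1%:R * c = n%:R * c + c by rewrite -natr1 mulrDl mul1r.
set e := error_bound n => IH e0.
have : 0 <= beta2 * (1 - beta2) * e by rewrite !mulr_ge0// subr_ge0.
nra.
Qed.

(** 4 = 1 + 3: each error counts three times through the following direction, and the initial one
    once more through the first direction. *)
Lemma direction_bound_sum : (0 < T)%N ->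
  \sum_(k < T) direction_bound k <=
  4 * (\sum_(k < T) error_bound k) +
  T%:R * (3 * beta1 ^+ 2 * sigma ^+ 2 + 3 * L ^+ 2 * D).
Proof.
case: T => // n _; set c := 3 * beta1 ^+ 2 * _ + _.
have c0 : 0 <= c by rewrite addr_ge0// mulr_ge0 ?sqr_ge0// mulr_ge0 ?sqr_ge0.
rewrite big_ord_recl [in leRHS]big_ord_recr/=.
under eq_bigr do rewrite -addrA -/c.
rewrite big_split/= sumr_const card_ord -mulr_sumr -mulr_natl.
rewrite -[n.+1%:R]natr1.
have := error_bound_ge0 n.
have : error_bound 0 <= \sum_(k < n.+1) error_bound k.
  by rewrite big_ord_recl lerDl sumr_ge0// => i _; exact: error_bound_ge0.
rewrite big_ord_recr/= => h1 h2.
have : 0 <= \sum_(k < n) error_bound k.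
  by rewrite sumr_ge0// => i _; exact: error_bound_ge0.
lra.
Qed.

Lemma lion_norm1_sum_le (a K : R) :
  0 <= beta1 <= 1 -> 0 < a -> 0 <= K ->
  (forall w, \sum_(k < T) norm1 (gradf (st k w).1.1) <=
    2 * a * (\sum_(k < T) norm2 (gradf (st k w).1.1 - lion_v k w) ^+ 2) + K) ->
  (\sum_(k < T) \int[P]_w (norm1 (gradf (st k w).1.1))%:E <=
    (2 * a * (\sum_(k < T) direction_bound k) + K)%:E)%E.
Proof.
move=> b01 a0 K0 pointwise.
have m1 k : measurable_fun [set: Omega]
    (fun w => norm1 (gradf (st k w).1.1)).
  exact: (measurable_x_fun k (fun x => norm1 (gradf x))).
rewrite -ge0_integral_sum//; last 2 first.
- by move=> k; exact/measurable_EFinP.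
- by move=> k w _; rewrite lee_fin norm1_ge0.
have mS : measurable_fun [set: Omega] (fun w =>
    \sum_(k < T) norm2 (gradf (st k w).1.1 - lion_v k w) ^+ 2).
  by apply: measurable_sum => k; exact: measurable_direction_error.
have Sle : (\int[P]_w
    (\sum_(k < T) norm2 (gradf (st k w).1.1 - lion_v k w) ^+ 2)%:E <=
    (\sum_(k < T) direction_bound k)%:E)%E.
  under eq_integral do rewrite -sumEFin.
  rewrite ge0_integral_sum//; last 2 first.
  - by move=> k; apply/measurable_EFinP; exact: measurable_direction_error.
  - by move=> k w _; rewrite lee_fin sqr_norm2_ge0.
  by rewrite -sumEFin; apply: lee_sum => k _; exact: direction_error_le.
(* The zero function fills the second slot of [ge0_integral_le_comb]. *)
have z0 : (\int[P]_w (0 : R)%:E <= (0 : R)%:E)%E by rewrite integral0.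
have -> : 2 * a * (\sum_(k < T) direction_bound k) + K =
  2 * a * (\sum_(k < T) direction_bound k) + 0 * 0 + K by rewrite mul0r addr0.
under eq_integral do rewrite sumEFin.
apply: (ge0_integral_le_comb P _ _ (cst 0) _ _ _ _ _ _ mS _ _ _ _ _ _ _ _ Sle z0) => //.
- exact: measurable_sum.
- by move=> w; rewrite sumr_ge0// => k _; exact: norm1_ge0.
- by move=> w; rewrite sumr_ge0// => k _; exact: sqr_norm2_ge0.
- by rewrite mulr_ge0// ltW.
- by move=> w; rewrite mul0r addr0.
Qed.

End Lion.

(** * Arithmetic of the rate *)

Section Rate.
Context {R : realType}.

(* Here [tau] is [T^(1/3)] and [delta] is [d^(1/2)]. *)
Lemma rate_le (L sigma Delta cb ce cB tau delta b1 S B : R)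
  (eta := ce / delta / tau ^+ 2) (b2 := cb / tau ^+ 2)
  (D := 9 / 4 * eta ^+ 2 * delta ^+ 2) :
  0 < cb -> 0 < ce -> 0 < cB -> 1 <= tau -> 0 < delta ->
  b1 ^+ 2 <= b2 -> cB * tau <= B ->
  b2 * S <= sigma ^+ 2 / B +
    tau ^+ 3 * (2 * b2 ^+ 2 * sigma ^+ 2 + 8 * L ^+ 2 * D) ->
  (2 * (delta * tau) *
     (4 * S + tau ^+ 3 * (3 * b1 ^+ 2 * sigma ^+ 2 + 3 * L ^+ 2 * D)) +
   (2 * Delta / eta + tau ^+ 3 * (2 * delta ^+ 2 / (delta * tau) +
      9 / 4 * (L ^+ 2 + 1) * (eta * delta ^+ 2)))) / tau ^+ 3 <=
  (2 * (4 * ((sigma ^+ 2 / cB + (2 * cb ^+ 2 * sigma ^+ 2 +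
      18 * L ^+ 2 * ce ^+ 2)) / cb) +
    (3 * cb * sigma ^+ 2 + 27 / 4 * L ^+ 2 * ce ^+ 2)) +
   2 * Delta / ce + 2 + 9 / 4 * (L ^+ 2 + 1) * ce) * (delta / tau).
Proof.
move=> cb0 ce0 cB0 tau1 delta0 b12 cBB SE.
have tau0 : 0 < tau by exact: lt_le_trans tau1.
have tn0 : tau != 0 by rewrite gt_eqF.
have dn0 : delta != 0 by rewrite gt_eqF.
have cbn0 : cb != 0 by rewrite gt_eqF.
have cen0 : ce != 0 by rewrite gt_eqF.
have cBn0 : cB != 0 by rewrite gt_eqF.
(* In [K0], 18 = 8 * 9/4; in [K1], 27/4 = 3 * 9/4. Both 9/4 come from [D]. *)
set K0 := 2 * cb ^+ 2 * sigma ^+ 2 + 18 * L ^+ 2 * ce ^+ 2.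
set K1 := 3 * cb * sigma ^+ 2 + 27 / 4 * L ^+ 2 * ce ^+ 2.
set K2 := (sigma ^+ 2 / cB + K0) / cb.
have S_le : S <= K2 * tau.
  have sB : sigma ^+ 2 / B <= sigma ^+ 2 / (cB * tau).
    rewrite ler_wpM2l ?sqr_ge0// lef_pV2 ?posrE ?mulr_gt0//.
    by apply: lt_le_trans cBB; rewrite mulr_gt0.
  have b20 : 0 < b2 by rewrite divr_gt0// exprn_gt0.
  rewrite -(ler_pM2l b20); apply: (le_trans SE); apply: (le_trans (lerD sB (lexx _))).
  rewrite le_eqVlt; apply/orP; left; apply/eqP.
  rewrite /K2 /K0 /D /b2 /eta; field.
  by rewrite tn0 dn0 cbn0 cBn0.
(* b1^2 <= b2 makes the noise term of order tau; the drift term is of order 1 / tau, which is at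
   most tau. *)
have tau4 : tau ^+ 3 * (3 * b1 ^+ 2 * sigma ^+ 2 + 3 * L ^+ 2 * D) <= K1 * tau.
  have h1 : b1 ^+ 2 * sigma ^+ 2 <= b2 * sigma ^+ 2 by rewrite ler_wpM2r ?sqr_ge0.
  apply: (@le_trans _ _ (tau ^+ 3 * (3 * (b2 * sigma ^+ 2) + 3 * L ^+ 2 * D))).
    by rewrite ler_wpM2l ?exprn_ge0 ?(ltW tau0)//; lra.
  have -> : tau ^+ 3 * (3 * (b2 * sigma ^+ 2) + 3 * L ^+ 2 * D) =
    3 * cb * sigma ^+ 2 * tau + 27 / 4 * L ^+ 2 * ce ^+ 2 * tau^-1.
    by rewrite /b2 /D /eta; field; rewrite tn0 dn0.
  rewrite /K1 [leRHS]mulrDl lerD2l ler_wpM2l//.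
    by rewrite mulr_ge0 ?sqr_ge0// mulr_ge0 ?sqr_ge0.
  by apply: (le_trans _ tau1); rewrite invf_le1.
have t3 : 0 < tau ^+ 3 by rewrite exprn_gt0.
rewrite ler_pdivrMr//.
have -> : 2 * Delta / eta = 2 * Delta / ce * (delta * tau ^+ 2).
  by rewrite /eta; field; rewrite tn0 dn0 cen0.
have -> : 2 * delta ^+ 2 / (delta * tau) = 2 * delta / tau.
  by field; rewrite tn0 dn0.
have -> : (2 * (4 * K2 + K1) + 2 * Delta / ce + 2 + 9 / 4 * (L ^+ 2 + 1) * ce) *
    (delta / tau) * tau ^+ 3 =
  2 * (delta * tau) * (4 * (K2 * tau) + K1 * tau) +
  (2 * Delta / ce * (delta * tau ^+ 2) + (2 * delta * tau ^+ 2 +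
   9 / 4 * (L ^+ 2 + 1) * (ce * delta * tau ^+ 2))).
  by field; rewrite tn0 cen0.
apply: lerD.
  by rewrite ler_wpM2l// ?mulr_ge0 ?(ltW delta0) ?(ltW tau0)//; lra.
rewrite lerD2l.
have -> : tau ^+ 3 * (2 * delta / tau +
    9 / 4 * (L ^+ 2 + 1) * (eta * delta ^+ 2)) =
  2 * delta * tau ^+ 2 + 9 / 4 * (L ^+ 2 + 1) * (ce * delta * tau).
  by rewrite /eta; field; rewrite tn0 dn0.
rewrite lerD2l ler_wpM2l//.
  by rewrite mulr_ge0// addr_ge0 ?sqr_ge0.
have cd0 : 0 <= ce * delta by rewrite mulr_ge0// ltW.
by rewrite ler_wpM2l// expr2 ler_peMl// ltW.
Qed.

End Rate.

Theorem theorem2 (R : realType) (L sigma Deltaf cbeta ceta cB : R)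
  (hcbeta : 0 < cbeta) (hceta : 0 < ceta) (hcB : 0 < cB) :
  exists C : R,
  forall (d : nat) (dX dO : measure_display)
    (Xi : measurableType dX) (mu : probability Xi R)
    (Omega : measurableType dO) (P : probability Omega R)
    (xi : nat -> Omega -> Xi)
    (f : 'rV[R]_d -> R) (gradf : 'rV[R]_d -> 'rV[R]_d)
    (G : 'rV[R]_d -> Xi -> 'rV[R]_d)
    (T B0 : nat) (beta1 beta2 eta lambda : R) (x1 : 'rV[R]_d),
  (0 < d)%N ->
  (* gradf is the gradient of f *)
  (forall x v : 'rV[R]_d, is_derive x v f (dotv (gradf x) v)) ->
  (* measurability of the oracle (implicit in the paper) *)
  (forall (x : 'rV[R]_d) (i : 'I_d), measurable_fun setT (fun z => G x z 0 i)) ->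
  (forall (X : Omega -> 'rV[R]_d) (n : nat),
     (forall i : 'I_d, measurable_fun setT (fun w => X w 0 i)) ->
     forall i : 'I_d, measurable_fun setT (fun w => G (X w) (xi n w) 0 i)) ->
  (* (A2) mean-squared smoothness *)
  (forall x y : 'rV[R]_d,
     (\int[mu]_z ((norm2 (G x z - G y z)) ^+ 2)%:E <=
        (L ^+ 2 * (norm2 (x - y)) ^+ 2)%:E)%E) ->
  (* (A3) unbiasedness and bounded variance *)
  (forall (x : 'rV[R]_d) (i : 'I_d),
     mu.-integrable setT (fun z => (G x z 0 i)%:E) /\
     (\int[mu]_z (G x z 0 i)%:E = (gradf x 0 i)%:E)%E) ->
  (forall x : 'rV[R]_d,
     (\int[mu]_z ((norm2 (G x z - gradf x)) ^+ 2)%:E <= (sigma ^+ 2)%:E)%E) ->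
  (* (A4) *)
  has_lbound (range f) ->
  f x1 - inf (range f) <= Deltaf ->
  (* i.i.d. samples *)
  iid_seq P mu xi ->
  (* parameters *)
  (1 <= T)%N ->
  B0 = maxn 1 `|Num.ceil (cB * T%:R `^ (3%:R^-1))|%N ->
  beta2 = cbeta * T%:R `^ (- (2%:R / 3%:R)) ->
  beta2 <= 1 ->
  beta2 <= beta1 -> beta1 <= Num.sqrt beta2 ->
  eta = ceta * d%:R `^ (- 2%:R^-1) * T%:R `^ (- (2%:R / 3%:R)) ->
  0 <= lambda -> lambda <= (2 * eta * T%:R)^-1 ->
  normInf x1 <= eta ->
  ((T%:R)^-1%:E *
     \sum_(1 <= t < T.+1)
        \int[P]_w (norm1 (gradf (lion_x G B0 beta1 beta2 eta lambda x1
                                   (fun n => xi n w) t)))%:E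
   <= (C * (d%:R `^ (2%:R^-1) / T%:R `^ (3%:R^-1)))%:E)%E.
Proof.
(* The factor of delta / tau in [rate_le], free of [d] and [T]. *)
exists (2 * (4 * ((sigma ^+ 2 / cB + (2 * cbeta ^+ 2 * sigma ^+ 2 +
      18 * L ^+ 2 * ceta ^+ 2)) / cbeta) +
    (3 * cbeta * sigma ^+ 2 + 27 / 4 * L ^+ 2 * ceta ^+ 2)) +
   2 * Deltaf / ceta + 2 + 9 / 4 * (L ^+ 2 + 1) * ceta).
move=> d dX dO Xi mu Omega P xi f gradf G T B0 beta1 beta2 eta lambda x1 d0
  gradP mG _ smooth unbiased noise fb fD iid T1 B0E b2E b2le b12 b1s etaE
  lambda0 lambdaT x1eta.
set tau := T%:R `^ (3%:R^-1).
set delta := d%:R `^ (2%:R^-1).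
have Tge1 : 1 <= T%:R :> R by rewrite ler1n.
have tau0 : 0 < tau by rewrite powR_gt0// ltr0n.
have tau3 : T%:R = tau ^+ 3.
  by rewrite -powR_mulrn ?ltW// /tau -powRrM mulVf// powRr1.
have tau1 : 1 <= tau.
  by rewrite leNgt; apply/negP => tlt; have : tau ^+ 3 < 1;
    [rewrite exprn_ilt1 ?ltW|rewrite -tau3 ltNge Tge1].
have delta0 : 0 < delta by rewrite powR_gt0// ltr0n.
have delta2 : d%:R = delta ^+ 2.
  by rewrite -powR_mulrn ?ltW// /delta -powRrM mulVf// powRr1.
have tau2 : T%:R `^ (- (2%:R / 3%:R)) = (tau ^+ 2)^-1.
  by rewrite powRN mulrC powRrM -/tau powR_mulrn// ltW.
rewrite tau2 in b2E; rewrite tau2 powRN -/delta in etaE.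
have eta0 : 0 < eta by rewrite etaE !mulr_gt0 ?invr_gt0 ?exprn_gt0.
have b20 : 0 < beta2 by rewrite b2E mulr_gt0 ?invr_gt0 ?exprn_gt0.
have b10 : 0 <= beta1 by rewrite (le_trans _ b12)// ltW.
have b1sq : beta1 ^+ 2 <= beta2.
  by rewrite -[leRHS](sqr_sqrtr (ltW b20)) lerXn2r ?nnegrE ?sqrtr_ge0.
have b11 : beta1 <= 1.
  by rewrite -(@ler_pXn2r _ 2) ?nnegrE// expr1n (le_trans b1sq).
have B0_gt0 : (0 < B0)%N by rewrite B0E leq_max.
have cBB : cB * tau <= B0%:R.
  apply: le_trans (ceil_ge _) _.
  rewrite B0E -/tau.
  (* Nonnegativity makes the absolute value in the batch size equal to the ceiling. *)
  have c0 : 0 <= Num.ceil (cB * tau).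
    by rewrite ceil_ge0 (lt_le_trans (ltrN10 _))// mulr_ge0 ?ltW.
  rewrite -{1}(gez0_abs c0) ler_nat leq_max leqnn orbT//.
have lip := gradf_lipschitz mu G gradf L mG smooth unbiased.
pose st k w := lion_state G B0 beta1 beta2 eta lambda x1 (fun n => xi n w) k.
pose v := lion_v xi G B0 beta1 beta2 eta lambda x1.
pose D := 9 / 4 * eta ^+ 2 * d%:R.
have xS w k : (st k.+1 w).1.1 = (st k w).1.1 -
    eta *: (signv (v k w) + lambda *: (st k w).1.1).
  by rewrite lion_x_next lion_xS.
have x1c w i : `|(st 0 w).1.1 0 i| <= eta by apply: le_trans (normInf_ge _ _) _.
have stepD k w : (k < T)%N -> norm2 ((st k w).1.2 - (st k w).1.1) ^+ 2 <= D.
  move=> kT; rewrite -lion_x_next.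
  exact: (sign_iterate_step eta lambda _ _ eta0 lambda0 (xS w) (x1c w) T lambdaT).
have a0 : 0 < delta * tau by rewrite mulr_gt0.
have D0 : 0 <= D by rewrite mulr_ge0// mulr_ge0// sqr_ge0.
have b201 : 0 <= beta2 <= 1 by rewrite ltW.
have b101 : 0 <= beta1 <= 1 by rewrite b10.
pose K := 2 * Deltaf / eta + T%:R * (2 * d%:R / (delta * tau) +
  9 / 4 * (L ^+ 2 + 1) * (eta * d%:R)).
have K_ge0 : 0 <= K.
  (* [Deltaf] dominates f x1 - inf f, which is nonnegative. *)
  have Df0 : 0 <= Deltaf.
    by apply: le_trans fD; rewrite subr_ge0; apply: ge_inf => //; exists x1.
  have L0 : 0 <= 9 / 4 * (L ^+ 2 + 1) by rewrite mulr_ge0// addr_ge0 ?sqr_ge0.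
  apply: addr_ge0; first by rewrite divr_ge0 ?mulr_ge0// ltW.
  apply: mulr_ge0 => //; apply: addr_ge0; first by rewrite divr_ge0// ltW.
  by apply: mulr_ge0 => //; rewrite mulr_ge0// ltW.
have bound := lion_norm1_sum_le P mu xi G gradf L sigma mG smooth unbiased
  noise iid B0 beta1 beta2 eta lambda x1 B0_gt0 D T b201 D0 stepD
  (delta * tau) K b101 a0 K_ge0
  (fun w => sign_descent_sum f gradf L gradP lip eta lambda _ _ eta0 lambda0
    (xS w) (x1c w) T lambdaT (delta * tau) Deltaf a0 fb fD).
(* Shifts t = 1, ..., T to k = t - 1, the state index at which [lion_x] reads x_t. *)
rewrite big_add1 big_mkord.
apply: (@le_trans _ _ ((T%:R)^-1%:E * _)%E); first exact: lee_wpmul2l bound.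
rewrite -EFinM lee_fin.
set E := error_bound L sigma B0 beta2 D.
have E_ge0 k : 0 <= E k by exact: error_bound_ge0.
have b2S : beta2 * (\sum_(k < T) E k) <= sigma ^+ 2 / B0%:R +
    T%:R * (2 * beta2 ^+ 2 * sigma ^+ 2 + 8 * L ^+ 2 * D).
  apply: le_trans (error_bound_sum L sigma B0 beta2 D b201 D0 T) _.
  by rewrite lerD2r gerBl E_ge0.
have dS := direction_bound_sum L sigma B0 beta1 beta2 D T D0 T1.
have := rate_le L sigma Deltaf cbeta ceta cB tau delta beta1
  (\sum_(k < T) E k) B0%:R hcbeta hceta hcB tau1 delta0.
rewrite -b2E -etaE -delta2 -/D -tau3 => /(_ b1sq cBB b2S).
apply: le_trans; rewrite mulrC ler_wpM2r ?invr_ge0//.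
by rewrite lerD2r; apply: ler_wpM2l => //; rewrite mulr_ge0// ltW.
Qed.
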